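(* Let $A\in\mathbb{R}^{n\times n}$, $b_1,\dots,b_m\in\mathbb{R}^n$ with $m\ge1$, and $T>0$. Let $C\subseteq\Delta_m$ be nonempty, compact and convex with $C\cap X_T\neq\emptyset$, let $\mathcal L_C:=\operatorname{lin}(C-C)$, and suppose that $\operatorname{Ker}\Phi_T\cap\mathcal L_C=\{0\}$. Let $f\in\{f_{\rm V},f_{\rm A}\}$. Then the problem of minimizing $f(p)$ subject to $p\in C\cap X_T$ has a unique optimal solution $p^\star$. If $\mathcal L_C\neq\{0\}$, then, from every $p^{(0)}\in C\cap X_T$, the domain-aware Armijo projected gradient method (described in the context, with $U=X_T$) with $\varepsilon=0$ either terminates at $p^\star$ or converges linearly to $p^\star$; namely, the generated iterates satisfy $$\|p^{(k)}-p^\star\|\le\sqrt{\frac{2\big(f(p^{(0)})-f(p^\star)\big)}{\mu}}\;\gamma^{k/2},\qquad \gamma:=1-\sigma\min\{1,\mu\underline\alpha\}\in(0,1),$$ where $\mu=\mu_{\rm V}:=\kappa_{C,T}^2/\beta_T^2$ if $f=f_{\rm V}$ and $\mu=\mu_{\rm A}:=2\kappa_{C,T}^2/\beta_T^3$ if $f=f_{\rm A}$, with $$\kappa_{C,T}:=\min_{v\in\mathcal L_C,\ \|v\|=1}\|\Phi_T(v)\|_{\rm F},\qquad \beta_T:=\max_{p\in C}\lambda_{\max}(W(p,T)).$$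
   Context: Scoring problem: $\Delta_m:=\{p\in\mathbb{R}^m\mid p_i\ge0,\ \sum_{i=1}^m p_i=1\}$; $W_i(T):=\int_0^T e^{At}b_ib_i^\top e^{A^\top t}\,dt$; $\Phi_T:\mathbb{R}^m\to\mathbb{S}^n$ (real symmetric $n\times n$ matrices) is the linear map $\Phi_T(v):=\sum_{i=1}^m v_iW_i(T)$, and $W(p,T):=\Phi_T(p)$; $X_T:=\{p\in\mathbb{R}^m\mid W(p,T)\succ O\}$ (positive definite), an open convex set; for $p\in X_T$, $f_{\rm V}(p):=-\log\det W(p,T)$ and $f_{\rm A}(p):=\operatorname{tr}(W(p,T)^{-1})$. Notation: $\|\cdot\|$ is the Euclidean norm, $\|\cdot\|_{\rm F}$ the Frobenius norm, $\|\cdot\|_2$ the spectral norm, $\lambda_{\max}$ the largest eigenvalue, $P_C$ the Euclidean projection onto $C$, $X_T^c=\mathbb{R}^m\setminus X_T$, $\operatorname{dist}(A,B)=\inf\{\|a-b\|: a\in A,b\in B\}$, $\operatorname{dist}(q,B)=\operatorname{dist}(\{q\},B)$, $C-C=\{p-q\mid p,q\in C\}$, and $\operatorname{lin}$ is linear span. The constant $\underline\alpha$: $\mathcal F^{(0)}:=\{p\in C\cap X_T\mid f(p)\le f(p^{(0)})\}$, $d:=\operatorname{dist}(\mathcal F^{(0)},X_T^c)$, $r:=\min\{1,d/2\}$, $\mathcal K_r:=\{q\in\mathbb{R}^m\mid \operatorname{dist}(q,\mathcal F^{(0)})\le r\}$ (here $d>0$ and $\mathcal K_r$ is a compact subset of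 $X_T$), $G:=\max\{1,\max_{p\in\mathcal F^{(0)}}\|\nabla f(p)\|\}$, $L:=\max\{1,\max_{q\in\mathcal K_r}\|\nabla^2 f(q)\|_2\}$, $\alpha_\star:=\min\{r/G,\,2(1-\sigma)/L\}$, and $\underline\alpha:=\min\{\bar\alpha,\rho\alpha_\star\}>0$. Domain-aware Armijo projected gradient method (with $U=X_T$). Input: $p^{(0)}\in C\cap U$, $\bar\alpha>0$, $\sigma,\rho\in(0,1)$, $\varepsilon\ge0$. For $k=0,1,\dots$: (backtracking loop) start with $\alpha:=\bar\alpha$ and repeat: set $q:=P_C(p^{(k)}-\alpha\nabla f(p^{(k)}))$; if $q\in U$ and (tested only when $q\in U$) $f(q)\le f(p^{(k)})+\sigma\nabla f(p^{(k)})^\top(q-p^{(k)})$, accept the trial by setting $\alpha_k:=\alpha$, $\tilde p^{(k)}:=q$ and exit the loop; otherwise replace $\alpha$ by $\rho\alpha$ and repeat. After acceptance, if $\|\tilde p^{(k)}-p^{(k)}\|/\alpha_k\le\varepsilon$, terminate and return $p^{(k)}$; otherwise set $p^{(k+1)}:=\tilde p^{(k)}$. *)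

(* Defs.v *)
From HB Require Import structures.
From mathcomp Require Import all_boot all_order all_algebra.
From mathcomp Require Import all_classical all_reals all_analysis.
Set Implicit Arguments.
Unset Strict Implicit.
Unset Printing Implicit Defensive.
Import Order.TTheory GRing.Theory Num.Theory.
Import numFieldNormedType.Exports.
Local Open Scope classical_set_scope.
Local Open Scope ring_scope.

(* Conventions.  Points of R^m are row vectors 'rV[R]_m, points of the state
   space R^n are column vectors.  The topology on 'rV[R]_m is the library's
   (product) one, which coincides with the Euclidean one, but the library norm
   `|_| on matrices is the max norm, hence the norms below.  Each maximum or
   minimum over a set of reals is written [sup] or [inf], which has the same
   value when it is attained; [sup] and [inf] are 0 by convention on sets that
   are empty or unbounded. *)

Definition dot (R : realType) (m : nat) (u v : 'rV[R]_m) : R :=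
  \sum_i u 0 i * v 0 i.

(* On row and column vectors, this is the Euclidean norm. *)
Definition frobenius (R : realType) (m n : nat) (M : 'M[R]_(m, n)) : R :=
  Num.sqrt (\sum_i \sum_j M i j ^+ 2).

Definition spectral_norm (R : realType) (m : nat) (M : 'M[R]_m) : R :=
  sup [set frobenius (M *m x) | x in [set x : 'cV[R]_m | frobenius x = 1]].

Definition lambda_max (R : realType) (n : nat) (M : 'M[R]_n) : R :=
  sup [set a | eigenvalue M a].

Definition posdef (R : realType) (n : nat) (M : 'M[R]_n) : Prop :=
  M^T = M /\ forall x : 'cV[R]_n, x != 0 -> 0 < (x^T *m M *m x) 0 0.

Definition mxexp (R : realType) (n : nat) (M : 'M[R]_n) : 'M[R]_n :=
  limn (series (fun k : nat => (k`!%:R)^-1 *: M ^+ k)).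

Definition lin (R : realType) (m : nat) (S : set 'rV[R]_m) : set 'rV[R]_m :=
  [set v | exists (k : nat) (c : 'I_k -> R) (s : 'I_k -> 'rV[R]_m),
    (forall i, S (s i)) /\ v = \sum_i c i *: s i].

Definition set_diff_vec (R : realType) (m : nat) (C : set 'rV[R]_m) :
    set 'rV[R]_m :=
  [set p - q | p in C & q in C].

Definition dist (R : realType) (m : nat) (X Y : set 'rV[R]_m) : R :=
  inf [set frobenius (x - y) | x in X & y in Y].

(* Euclidean projection onto C (junk when there is no nearest point; the
   nearest point is unique for C convex). *)
Definition proj (R : realType) (m : nat) (C : set 'rV[R]_m) (x : 'rV[R]_m) :
    'rV[R]_m :=
  xget 0 [set q | C q /\ forall y, C y -> frobenius (x - q) <= frobenius (x - y)].

Definition grad (R : realType) (m : nat) (f : 'rV[R]_m -> R) (p : 'rV[R]_m) :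
    'rV[R]_m :=
  \row_i 'D_(delta_mx 0 i) f p.

Definition hessian (R : realType) (m : nat) (f : 'rV[R]_m -> R)
    (p : 'rV[R]_m) : 'M[R]_m :=
  \matrix_(i, j) 'D_(delta_mx 0 i) ('D_(delta_mx 0 j) f) p.

Definition simplex (R : realType) (m : nat) : set 'rV[R]_m :=
  [set p | (forall i, 0 <= p 0 i) /\ \sum_i p 0 i = 1].

Arguments simplex R m : clear implicits.

Definition is_optimal (R : realType) (m : nat) (f : 'rV[R]_m -> R)
    (S : set 'rV[R]_m) (p : 'rV[R]_m) : Prop :=
  S p /\ forall q, S q -> f p <= f q.

Definition gramian (R : realType) (n m : nat) (A : 'M[R]_n)
    (b : 'I_m -> 'cV[R]_n) (T : R) (i : 'I_m) : 'M[R]_n :=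
  \matrix_(j, k) (\int[lebesgue_measure]_(t in `[0, T])
    (mxexp (t *: A) *m b i *m (b i)^T *m mxexp (t *: A^T)) j k)%R.

Definition Phi (R : realType) (n m : nat) (A : 'M[R]_n)
    (b : 'I_m -> 'cV[R]_n) (T : R) (v : 'rV[R]_m) : 'M[R]_n :=
  \sum_i v 0 i *: gramian A b T i.

Definition X_ (R : realType) (n m : nat) (A : 'M[R]_n)
    (b : 'I_m -> 'cV[R]_n) (T : R) : set 'rV[R]_m :=
  [set p | posdef (Phi A b T p)].

(* The two objectives are meaningful on X_ only; outside they take the junk
   values of [ln] and [invmx]. *)
Definition fV (R : realType) (n m : nat) (A : 'M[R]_n)
    (b : 'I_m -> 'cV[R]_n) (T : R) (p : 'rV[R]_m) : R :=
  - ln (\det (Phi A b T p)).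

Definition fA (R : realType) (n m : nat) (A : 'M[R]_n)
    (b : 'I_m -> 'cV[R]_n) (T : R) (p : 'rV[R]_m) : R :=
  \tr (invmx (Phi A b T p)).

Definition kappa (R : realType) (n m : nat) (A : 'M[R]_n)
    (b : 'I_m -> 'cV[R]_n) (T : R) (C : set 'rV[R]_m) : R :=
  inf [set frobenius (Phi A b T v)
      | v in [set v | lin (set_diff_vec C) v /\ frobenius v = 1]].

Definition beta (R : realType) (n m : nat) (A : 'M[R]_n)
    (b : 'I_m -> 'cV[R]_n) (T : R) (C : set 'rV[R]_m) : R :=
  sup [set lambda_max (Phi A b T p) | p in C].

Definition muV (R : realType) (n m : nat) (A : 'M[R]_n)
    (b : 'I_m -> 'cV[R]_n) (T : R) (C : set 'rV[R]_m) : R :=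
  kappa A b T C ^+ 2 / beta A b T C ^+ 2.

Definition muA (R : realType) (n m : nat) (A : 'M[R]_n)
    (b : 'I_m -> 'cV[R]_n) (T : R) (C : set 'rV[R]_m) : R :=
  2 * kappa A b T C ^+ 2 / beta A b T C ^+ 3.

Definition sublevel (R : realType) (m : nat) (f : 'rV[R]_m -> R)
    (C U : set 'rV[R]_m) (p0 : 'rV[R]_m) : set 'rV[R]_m :=
  [set p | [/\ C p, U p & f p <= f p0]].

Definition nbhd_radius (R : realType) (m : nat) (f : 'rV[R]_m -> R)
    (C U : set 'rV[R]_m) (p0 : 'rV[R]_m) : R :=
  Num.min 1 (dist (sublevel f C U p0) (~` U) / 2).

Definition neighborhood (R : realType) (m : nat) (f : 'rV[R]_m -> R)
    (C U : set 'rV[R]_m) (p0 : 'rV[R]_m) : set 'rV[R]_m :=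
  [set q | dist [set q] (sublevel f C U p0) <= nbhd_radius f C U p0].

Definition grad_bound (R : realType) (m : nat) (f : 'rV[R]_m -> R)
    (C U : set 'rV[R]_m) (p0 : 'rV[R]_m) : R :=
  Num.max 1 (sup [set frobenius (grad f p) | p in sublevel f C U p0]).

Definition hess_bound (R : realType) (m : nat) (f : 'rV[R]_m -> R)
    (C U : set 'rV[R]_m) (p0 : 'rV[R]_m) : R :=
  Num.max 1 (sup [set spectral_norm (hessian f q)
                 | q in neighborhood f C U p0]).

Definition alpha_star (R : realType) (m : nat) (f : 'rV[R]_m -> R)
    (C U : set 'rV[R]_m) (p0 : 'rV[R]_m) (sigma : R) : R :=
  Num.min (nbhd_radius f C U p0 / grad_bound f C U p0)
          (2 * (1 - sigma) / hess_bound f C U p0).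

Definition alpha_low (R : realType) (m : nat) (f : 'rV[R]_m -> R)
    (C U : set 'rV[R]_m) (p0 : 'rV[R]_m) (abar sigma rho : R) : R :=
  Num.min abar (rho * alpha_star f C U p0 sigma).

Definition trial (R : realType) (m : nat) (f : 'rV[R]_m -> R)
    (C : set 'rV[R]_m) (p : 'rV[R]_m) (a : R) : 'rV[R]_m :=
  proj C (p - a *: grad f p).

Definition armijo (R : realType) (m : nat) (f : 'rV[R]_m -> R)
    (C U : set 'rV[R]_m) (sigma : R) (p : 'rV[R]_m) (a : R) : Prop :=
  let q := trial f C p a in
  U q /\ f q <= f p + sigma * dot (grad f p) (q - p).

(* The backtracking loop started at p halts, with step size a: the first
   accepted one among abar, rho * abar, rho ^ 2 * abar, and so on. *)
Definition backtrack (R : realType) (m : nat) (f : 'rV[R]_m -> R)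
    (C U : set 'rV[R]_m) (abar sigma rho : R) (p : 'rV[R]_m) (a : R) : Prop :=
  exists j : nat,
    [/\ a = rho ^+ j * abar, armijo f C U sigma p a
      & forall i : nat, (i < j)%N -> ~ armijo f C U sigma p (rho ^+ i * abar)].

(* [iterate _ k p]: the run from p0 reaches p^(k), and p^(k) = p.  A run that
   terminates at iteration k generates p^(0), ..., p^(k) only. *)
Inductive iterate (R : realType) (m : nat) (f : 'rV[R]_m -> R)
    (C U : set 'rV[R]_m) (abar sigma rho eps : R) (p0 : 'rV[R]_m) :
    nat -> 'rV[R]_m -> Prop :=
| iterate_start : iterate f C U abar sigma rho eps p0 0 p0
| iterate_next (k : nat) (p : 'rV[R]_m) (a : R) :
    iterate f C U abar sigma rho eps p0 k p ->
    backtrack f C U abar sigma rho p a ->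
    ~ (frobenius (trial f C p a - p) / a <= eps) ->
    iterate f C U abar sigma rho eps p0 k.+1 (trial f C p a).

Definition terminates_at (R : realType) (m : nat) (f : 'rV[R]_m -> R)
    (C U : set 'rV[R]_m) (abar sigma rho eps : R) (p0 p : 'rV[R]_m) : Prop :=
  exists (k : nat) (a : R),
    [/\ iterate f C U abar sigma rho eps p0 k p,
        backtrack f C U abar sigma rho p a
      & frobenius (trial f C p a - p) / a <= eps].

Definition runs_forever (R : realType) (m : nat) (f : 'rV[R]_m -> R)
    (C U : set 'rV[R]_m) (abar sigma rho eps : R) (p0 : 'rV[R]_m)
    (x : nat -> 'rV[R]_m) : Prop :=
  forall k, iterate f C U abar sigma rho eps p0 k (x k).

(* Main.v *)
Require Import Defs.
From HB Require Import structures.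
From mathcomp Require Import all_boot all_order all_algebra.
From mathcomp Require Import all_classical all_reals all_analysis.
From mathcomp Require Import ring lra.
Set Implicit Arguments.
Unset Strict Implicit.
Unset Printing Implicit Defensive.
Import Order.TTheory GRing.Theory Num.Theory.
Import numFieldNormedType.Exports.
Local Open Scope classical_set_scope.
Local Open Scope ring_scope.

(** The Gramians W_i are symmetric, so p |-> W(p,T) is a linear family of
    symmetric matrices (a pencil), and everything takes place on the open convex
    set X where this pencil is positive definite.

    Both scoring functions are strongly convex along the directions of C. With
    S = W(p,T)^-1 and V = Phi_T(v), the second derivative of f at p in the
    direction v is tr (S V S V) for - log det, and 2 tr (S V S V S) for the
    trace of the inverse. For p in C, W(p,T) is at most beta I, so S is at
    least I / beta, and these traces are at least |V|^2 / beta^2, respectively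
    2 |V|^2 / beta^3 (trace_SVSV_ge, trace_SVSVS_ge). On the span of C - C,
    |V| is at least kappa |v|, where kappa is positive because the continuous
    function v |-> |Phi_T(v)| has no zero on the compact unit sphere of that
    span (pencil_kappa_gt0). A second-order expansion along segments then gives
    strong convexity of modulus mu (scoring_strongly_convex).

    Both functions are also proper: where f is bounded above on C, the trace of
    S is bounded, hence W(p,T) >= c I for a common c > 0 (scoring_proper).
    Minimizing the continuous function f over a compact set of this kind yields
    an optimal solution (minimizer_exists), unique by strong convexity, or
    because C is a point when the span is zero. The lower bound c also shows
    that the sublevel set of p0 is at positive distance d from the complement
    of X, and, by linearity, that W(q,T) >= (c / 4) I at the points q within
    d / 2 of the sublevel set. Gradients and Hessians are therefore bounded
    there, the constants G and L are genuine bounds, and every step size up to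
    alpha_star passes the Armijo test (armijo_accept). Hence the accepted step
    sizes are at least alpha_low (backtrack_step).

    Finally, the trial point q minimizes over C the model
    y |-> grad f(p).(y - p) + |y - p|^2 / (2 a). Comparing it with the points
    of the segment from p to the minimizer gives
    grad f(p).(q - p) <= - min(1, mu a) (f(p) - f(pstar)) (trial_gap), so that
    each accepted step multiplies the gap f - f(pstar) by at most gamma
    (step_contracts), and the gap dominates (mu / 2) |p - pstar|^2
    (quadratic_growth). *)

(** * Quadratic forms and the Frobenius inner product *)

Definition qform (R : realType) (n : nat) (M : 'M[R]_n) (x y : 'cV[R]_n) : R :=
  (x^T *m M *m y) 0 0.

Section QuadraticForms.
Variable R : realType.

(** Evaluate the polynomial at its minimizer - b / c; when c = 0 it is affine
    and takes the value - 1 unless b = 0. *)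
Lemma discriminant_le (a b c : R) :
  0 <= c -> (forall t, 0 <= a + 2 * b * t + c * t ^+ 2) -> b ^+ 2 <= a * c.
Proof.
move=> c0 h; have [cp|] := ltP 0 c.
  have := h (- b / c).
  have -> : a + 2 * b * (- b / c) + c * (- b / c) ^+ 2 = (a * c - b ^+ 2) / c.
    by field; rewrite gt_eqF.
  by rewrite pmulr_lge0 ?invr_gt0// subr_ge0.
move=> cn; have {cn} ce : c = 0 by apply: le_anti; rewrite cn c0.
have [->|b0] := eqVneq b 0; first by rewrite ce mulr0 expr0n.
have := h (- (a + 1) / (2 * b)).
have -> : a + 2 * b * (- (a + 1) / (2 * b))
    + c * (- (a + 1) / (2 * b)) ^+ 2 = -1.
  by rewrite ce; field.
by rewrite oppr_ge0 ler10.
Qed.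

Lemma sqr_le_of_norm (x y : R) : `|x| <= y -> x ^+ 2 <= y ^+ 2.
Proof.
move=> h; rewrite -[x ^+ 2]real_normK ?num_real//.
by rewrite ler_pXn2r ?nnegrE// (le_trans _ h).
Qed.

Lemma frobenius_ge0 m n (M : 'M[R]_(m, n)) : 0 <= frobenius M.
Proof. exact: sqrtr_ge0. Qed.

Lemma frobenius_sqE m n (M : 'M[R]_(m, n)) :
  frobenius M ^+ 2 = \sum_i \sum_j M i j ^+ 2.
Proof.
by rewrite sqr_sqrtr//; do 2 (apply: sumr_ge0 => ? _); exact: sqr_ge0.
Qed.

Lemma mxtrace_trmul m n (M N : 'M[R]_(m, n)) :
  \tr (M^T *m N) = \sum_i \sum_j M i j * N i j.
Proof.
rewrite exchange_big; apply: eq_bigr => i _.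
by rewrite mxE; apply: eq_bigr => j _; rewrite mxE.
Qed.

Lemma frobenius_sq m n (M : 'M[R]_(m, n)) :
  frobenius M ^+ 2 = \tr (M^T *m M).
Proof.
by rewrite frobenius_sqE mxtrace_trmul; do 2 (apply: eq_bigr => ? _).
Qed.

Lemma frobenius_tr m n (M : 'M[R]_(m, n)) : frobenius M^T = frobenius M.
Proof.
rewrite /frobenius exchange_big; congr Num.sqrt.
by do 2 (apply: eq_bigr => ? _); rewrite mxE.
Qed.

Lemma frobenius_eq0 m n (M : 'M[R]_(m, n)) : frobenius M = 0 -> M = 0.
Proof.
move=> h; have : frobenius M ^+ 2 = 0 by rewrite h expr0n.
rewrite frobenius_sqE => /eqP; rewrite psumr_eq0; last first.
  by move=> i _; apply: sumr_ge0 => j _; exact: sqr_ge0.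
move=> /allP hi; apply/matrixP => i j; rewrite mxE; apply/eqP.
have := hi i (mem_index_enum _); rewrite /= psumr_eq0; last first.
  by move=> ? _; exact: sqr_ge0.
by move=> /allP /(_ j (mem_index_enum _)) /=; rewrite sqrf_eq0.
Qed.

Lemma frobenius0 m n : frobenius (0 : 'M[R]_(m, n)) = 0.
Proof.
rewrite /frobenius big1 ?sqrtr0// => i _.
by rewrite big1// => j _; rewrite mxE expr0n.
Qed.

Lemma frobenius_gt0 m n (M : 'M[R]_(m, n)) : M != 0 -> 0 < frobenius M.
Proof.
move=> M0; rewrite lt_neqAle frobenius_ge0 andbT eq_sym.
by apply: contra M0 => /eqP /frobenius_eq0 ->.
Qed.

Lemma frobeniusZ m n (c : R) (M : 'M[R]_(m, n)) :
  frobenius (c *: M) = `|c| * frobenius M.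
Proof.
apply/eqP; rewrite -(@eqrXn2 _ 2)// ?mulr_ge0 ?frobenius_ge0//.
rewrite exprMn real_normK ?num_real// !frobenius_sqE mulr_sumr; apply/eqP.
by apply: eq_bigr => i _; rewrite mulr_sumr; apply: eq_bigr => j _;
  rewrite mxE exprMn.
Qed.

Lemma frobeniusN m n (M : 'M[R]_(m, n)) : frobenius (- M) = frobenius M.
Proof. by rewrite -scaleN1r frobeniusZ normrN1 mul1r. Qed.

Lemma frobenius_distC m n (M N : 'M[R]_(m, n)) :
  frobenius (M - N) = frobenius (N - M).
Proof. by rewrite -opprB frobeniusN. Qed.

Lemma mxtrace_CauchySchwarz m n (M N : 'M[R]_(m, n)) :
  `|\tr (M^T *m N)| <= frobenius M * frobenius N.
Proof.
rewrite -(@ler_pXn2r _ 2)// ?nnegrE ?mulr_ge0 ?frobenius_ge0//.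
rewrite real_normK ?num_real// exprMn.
apply: discriminant_le; first exact: sqr_ge0.
move=> t; have := sqr_ge0 (frobenius (M + t *: N)); rewrite !frobenius_sq.
have -> : (M + t *: N)^T = M^T + t *: N^T by rewrite linearD linearZ.
have e : \tr (N^T *m M) = \tr (M^T *m N).
  by rewrite -mxtrace_tr trmx_mul trmxK.
rewrite mulmxDl !mulmxDr -!scalemxAl -!scalemxAr !mxtraceD !mxtraceZ e.
by move=> h; rewrite (le_trans h)// le_eqVlt; apply/orP; left; apply/eqP; ring.
Qed.

Lemma frobeniusM m n k (M : 'M[R]_(m, n)) (N : 'M[R]_(n, k)) :
  frobenius (M *m N) <= frobenius M * frobenius N.
Proof.
rewrite -(@ler_pXn2r _ 2)// ?nnegrE ?mulr_ge0 ?frobenius_ge0//.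
rewrite exprMn frobenius_sqE (frobenius_sqE M) big_distrl /=.
apply: ler_sum => i _.
rewrite -[frobenius N]frobenius_tr frobenius_sqE big_distrr /=.
apply: ler_sum => j _.
have := mxtrace_CauchySchwarz (row i M)^T (col j N).
move/sqr_le_of_norm.
rewrite trmxK exprMn frobenius_tr !frobenius_sqE.
rewrite big_ord1 /mxtrace big_ord1 !mxE.
have -> : \sum_j0 row i M 0 j0 * col j N j0 0 = \sum_j0 M i j0 * N j0 j.
  by apply: eq_bigr => ? _; rewrite !mxE.
have -> : \sum_j0 row i M 0 j0 ^+ 2 = \sum_j0 M i j0 ^+ 2.
  by apply: eq_bigr => ? _; rewrite !mxE.
suff -> : \sum_i0 \sum_j0 col j N i0 j0 ^+ 2 = \sum_j0 N^T j j0 ^+ 2 by [].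
by apply: eq_bigr => l _; rewrite big_ord1 !mxE.
Qed.

Lemma frobeniusD m n (M N : 'M[R]_(m, n)) :
  frobenius (M + N) <= frobenius M + frobenius N.
Proof.
rewrite -(@ler_pXn2r _ 2)// ?nnegrE ?addr_ge0 ?frobenius_ge0//.
have -> : frobenius (M + N) ^+ 2
    = frobenius M ^+ 2 + 2 * \tr (M^T *m N) + frobenius N ^+ 2.
  have e : \tr (N^T *m M) = \tr (M^T *m N).
    by rewrite -mxtrace_tr trmx_mul trmxK.
  have e' : (M + N)^T = M^T + N^T by rewrite linearD.
  by rewrite !frobenius_sq e' mulmxDl !mulmxDr !mxtraceD e; ring.
have := mxtrace_CauchySchwarz M N; have := ler_norm (\tr (M^T *m N)).
rewrite sqrrD; lra.
Qed.

Lemma frobenius_sum m n (I : Type) (s : seq I) (F : I -> 'M[R]_(m, n)) :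
  frobenius (\sum_(i <- s) F i) <= \sum_(i <- s) frobenius (F i).
Proof.
elim: s => [|i s IH]; first by rewrite !big_nil frobenius0.
by rewrite !big_cons; apply: le_trans (frobeniusD _ _) _; rewrite lerD2l.
Qed.

Lemma frobenius_coord m n (M : 'M[R]_(m, n)) i j : `|M i j| <= frobenius M.
Proof.
rewrite -(@ler_pXn2r _ 2)// ?nnegrE ?frobenius_ge0//.
rewrite real_normK ?num_real// frobenius_sqE (bigD1 i)//= (bigD1 j)//= -addrA.
rewrite lerDl addr_ge0//; do ?(apply: sumr_ge0 => ? _); exact: sqr_ge0.
Qed.

Lemma frobenius_le_entries k l (M : 'M[R]_(k, l)) (K : R) :
  (forall i j, `|M i j| <= K) ->
  frobenius M <= Num.sqrt (\sum_(i < k) \sum_(j < l) K ^+ 2).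
Proof.
move=> h; apply: ler_wsqrtr; apply: ler_sum => i _; apply: ler_sum => j _.
exact: sqr_le_of_norm.
Qed.

Lemma mxtraceM_le_norm n (A B : 'M[R]_n) :
  `|\tr (A *m B)| <= frobenius A * frobenius B.
Proof. by have := mxtrace_CauchySchwarz A^T B; rewrite trmxK frobenius_tr. Qed.

Lemma frobeniusM_le k l s (A : 'M[R]_(k, l)) (B : 'M[R]_(l, s)) (a b : R) :
  frobenius A <= a -> frobenius B <= b -> frobenius (A *m B) <= a * b.
Proof.
move=> ha hb; apply: le_trans (frobeniusM _ _) _.
by apply: ler_pM => //; exact: frobenius_ge0.
Qed.

Lemma mxtraceM_le n (A B : 'M[R]_n) (a b : R) :
  frobenius A <= a -> frobenius B <= b -> `|\tr (A *m B)| <= a * b.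
Proof.
move=> ha hb; apply: le_trans (mxtraceM_le_norm _ _) _.
by apply: ler_pM => //; exact: frobenius_ge0.
Qed.

Lemma qform_tr n (M : 'M[R]_n) x y : qform M x y = \tr (x^T *m M *m y).
Proof. by rewrite /mxtrace big_ord1. Qed.

Lemma qformC n (M : 'M[R]_n) x y : M^T = M -> qform M x y = qform M y x.
Proof.
move=> sM; rewrite !qform_tr -mxtrace_tr !trmx_mul trmxK sM.
by rewrite mulmxA.
Qed.

Lemma qform1 n (x : 'cV[R]_n) : qform 1%:M x x = frobenius x ^+ 2.
Proof. by rewrite qform_tr mulmx1 frobenius_sq. Qed.

Lemma qform_CauchySchwarz n (M : 'M[R]_n) x y :
  M^T = M -> (forall z, 0 <= qform M z z) ->
  qform M x y ^+ 2 <= qform M x x * qform M y y.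
Proof.
move=> sM pM; apply: discriminant_le => // t.
have := pM (x + t *: y).
have -> : qform M (x + t *: y) (x + t *: y)
  = qform M x x + t * qform M x y + (t * qform M y x + t * t * qform M y y).
  have e : (x + t *: y)^T = x^T + t *: y^T by rewrite linearD linearZ.
  rewrite !qform_tr e !mulmxDl !mulmxDr -!scalemxAl -!scalemxAr.
  by rewrite scalerA !mxtraceD !mxtraceZ; ring.
rewrite (qformC y x sM) => h.
by rewrite (le_trans h)// le_eqVlt; apply/orP; left; apply/eqP; ring.
Qed.

(** A vector on which a positive semidefinite form vanishes is in its kernel:
    by the Cauchy-Schwarz inequality it is orthogonal to everything. *)
Lemma psd_isotropic n (M : 'M[R]_n) x :
  M^T = M -> (forall z, 0 <= qform M z z) -> qform M x x = 0 -> M *m x = 0.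
Proof.
move=> sM pM x0; apply: frobenius_eq0.
have := qform_CauchySchwarz (M *m x) x sM pM; rewrite x0 mulr0.
rewrite {1}/qform -mulmxA => h.
suff : frobenius (M *m x) ^+ 2 = 0 by move=> /eqP; rewrite sqrf_eq0 => /eqP.
apply/eqP; rewrite -sqrf_eq0 eq_le sqr_ge0 andbT.
suff -> : frobenius (M *m x) ^+ 2 = ((M *m x)^T *m (M *m x)) 0 0 by [].
by rewrite frobenius_sq /mxtrace big_ord1.
Qed.

Lemma qform_delta n (M : 'M[R]_n) i j :
  qform M (delta_mx i 0) (delta_mx j 0) = M i j.
Proof. by rewrite /qform trmx_delta -rowE -colE !mxE. Qed.

Lemma frobenius_delta n (i : 'I_n) : frobenius (delta_mx i 0 : 'cV[R]_n) = 1.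
Proof.
apply/eqP; rewrite -(@eqrXn2 _ 2)// ?frobenius_ge0//.
by rewrite -qform1 qform_delta mxE eqxx expr1n.
Qed.

Lemma qformDZ n (M N : 'M[R]_n) (t : R) x :
  qform (M + t *: N) x x = qform M x x + t * qform N x x.
Proof.
by rewrite !qform_tr mulmxDr mulmxDl -scalemxAr -scalemxAl mxtraceD mxtraceZ.
Qed.

Lemma qform_le_frobenius n (M : 'M[R]_n) x :
  qform M x x <= frobenius M * frobenius x ^+ 2.
Proof.
rewrite qform_tr -mulmxA; apply: le_trans (ler_norm _) _.
apply: le_trans (mxtrace_CauchySchwarz _ _) _.
by rewrite mulrC expr2 mulrA ler_wpM2r ?frobenius_ge0// frobeniusM.
Qed.

End QuadraticForms.

(** * Positive definite matrices *)

(** The inequality M >= c I of the semidefinite order. *)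
Definition form_ge (R : realType) (n : nat) (c : R) (M : 'M[R]_n) : Prop :=
  forall x, c * frobenius x ^+ 2 <= qform M x x.

Section PositiveDefinite.
Variable R : realType.

Lemma posdef_psd n (M : 'M[R]_n) : posdef M -> forall x, 0 <= qform M x x.
Proof.
move=> [_ pM] x; have [->|/pM/ltW//] := eqVneq x 0.
by rewrite /qform mulmx0 mxE.
Qed.

Lemma form_ge_posdef n (c : R) (M : 'M[R]_n) :
  M^T = M -> 0 < c -> form_ge c M -> posdef M.
Proof.
move=> sM c0 h; split=> // x x0; apply: lt_le_trans (h x).
by rewrite mulr_gt0// exprn_gt0// frobenius_gt0.
Qed.

Lemma posdef_unitmx n (M : 'M[R]_n) : posdef M -> M \in unitmx.
Proof.
move=> [sM pM]; rewrite -row_free_unit -kermx_eq0.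
apply/eqP/row_matrixP => i; rewrite row0; apply/eqP/negPn/negP => r0.
have /pM : (row i (kermx M))^T != 0.
  by apply: contra r0 => /eqP h; rewrite -[row _ _]trmxK h trmx0.
by rewrite trmxK -row_mul mulmx_ker row0 mul0mx mxE ltxx.
Qed.

(** Cholesky factorization, by induction on the size: the Schur complement of
    a positive definite matrix is again positive definite. *)
Lemma posdef_factor n (M : 'M[R]_n) :
  posdef M -> exists B : 'M[R]_n, M = B^T *m B.
Proof.
elim: n M => [|n IH] M pM.
  by exists 0; apply/matrixP => -[].
have sM := pM.1.
pose a := M 0 0; pose u := ursubmx (M : 'M[R]_(1 + n)).
pose D := drsubmx (M : 'M[R]_(1 + n)).
have a0 : 0 < a.
  rewrite -[a](qform_delta M 0 0); apply: pM.2; apply/eqP => /matrixP /(_ 0 0).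
  by rewrite !mxE !eqxx /= => /eqP; rewrite oner_eq0.
have eM : M = block_mx a%:M u u^T D :> 'M[R]_(1 + n).
  rewrite -{1}[M](@submxK _ 1 n 1 n); congr block_mx.
    apply/matrixP => i j; rewrite !ord1 !mxE eqxx mulr1n.
    by congr (M _ _); apply/val_inj.
  by rewrite /u trmx_ursub sM.
have sD : D^T = D by rewrite /D trmx_drsub sM.
pose D' := D - a^-1 *: (u^T *m u).
have [B' eB'] : exists B : 'M[R]_n, D' = B^T *m B.
  apply: IH; split.
    by rewrite /D' linearB linearZ /= trmx_mul trmxK sD.
  move=> y y0; pose x : 'cV[R]_(1 + n) := col_mx (- a^-1 *: (u *m y)) y.
  have x0 : x != 0.
    by apply: contra y0 => /eqP h; rewrite -(col_mxKd (- a^-1 *: (u *m y)) y)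
      -/x h linear0.
  suff key : x^T *m (M : 'M[R]_(1 + n)) *m x = y^T *m D' *m y.
    by rewrite -key; exact: (pM.2 _ x0).
  have hM : (M : 'M[R]_(1 + n)) *m x = col_mx 0 (D' *m y).
    rewrite eM /x mul_block_col; congr col_mx.
      by rewrite mul_scalar_mx scalerA mulrN divff ?gt_eqF// scaleN1r addNr.
    by rewrite /D' mulmxBl -scalemxAr -scalemxAl scaleNr mulmxA addrC.
  by rewrite -mulmxA hM /x tr_col_mx mul_row_col mulmx0 add0r mulmxA.
pose B : 'M[R]_(1 + n) :=
  block_mx (Num.sqrt a)%:M ((Num.sqrt a)^-1 *: u) 0 B'.
have s0 : Num.sqrt a != 0 by rewrite gt_eqF// sqrtr_gt0.
suff eB : B^T *m B = block_mx a%:M u u^T D by exists B; exact: etrans (esym eB).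
rewrite /B tr_block_mx mulmx_block !trmx0 !mul0mx !mulmx0 !addr0.
have -> : ((Num.sqrt a)^-1 *: u)^T = (Num.sqrt a)^-1 *: u^T by rewrite linearZ.
rewrite tr_scalar_mx; congr block_mx.
- by rewrite -scalar_mxM -expr2 sqr_sqrtr// ltW.
- by rewrite mul_scalar_mx scalerA divff// scale1r.
- by rewrite mul_mx_scalar scalerA divff// scale1r.
- rewrite -eB' /D' -scalemxAl -scalemxAr scalerA -invfM -expr2.
  by rewrite sqr_sqrtr ?ltW// addrC subrK.
Qed.

Lemma posdef_det_gt0 n (M : 'M[R]_n) : posdef M -> 0 < \det M.
Proof.
move=> pM; have := posdef_unitmx pM; have [B ->] := posdef_factor pM.
rewrite unitmxE det_mulmx det_tr unitfE -expr2 sqrf_eq0 => B0.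
by rewrite exprn_even_gt0.
Qed.

(** Each entry satisfies M_ij^2 <= M_ii M_jj by the Cauchy-Schwarz inequality
    for the form of M; sum over i and j. *)
Lemma psd_frobenius_le_trace n (M : 'M[R]_n) :
  M^T = M -> (forall x, 0 <= qform M x x) -> frobenius M <= \tr M.
Proof.
move=> sM pM.
have d0 i : 0 <= M i i by rewrite -qform_delta.
rewrite -(@ler_pXn2r _ 2)// ?nnegrE ?frobenius_ge0 ?sumr_ge0//.
rewrite frobenius_sqE expr2 big_distrl /=; apply: ler_sum => i _.
rewrite big_distrr /=; apply: ler_sum => j _.
have := qform_CauchySchwarz (delta_mx i 0) (delta_mx j 0) sM pM.
by rewrite !qform_delta.
Qed.

Section Inverse.
Variables (n : nat) (M : 'M[R]_n).
Hypothesis pM : posdef M.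
Let S := invmx M.

Lemma invmx_posdef_sym : S^T = S.
Proof. by rewrite /S trmx_inv pM.1. Qed.

Lemma qform_invmx x : qform S x x = qform M (S *m x) (S *m x).
Proof.
rewrite /qform trmx_mul invmx_posdef_sym -!mulmxA.
by rewrite (mulmxA M) mulmxV ?posdef_unitmx// mul1mx.
Qed.

Lemma invmx_psd x : 0 <= qform S x x.
Proof. by rewrite qform_invmx; exact: posdef_psd. Qed.

(** Cauchy-Schwarz inequality for the form of M, applied to x and S x. *)
Lemma qform_invmx_ge x : frobenius x ^+ 2 ^+ 2 <= qform M x x * qform S x x.
Proof.
have := qform_CauchySchwarz x (S *m x) pM.1 (posdef_psd pM).
rewrite -qform_invmx; congr (_ ^+ 2 <= _).
by rewrite /qform -mulmxA (mulmxA M) mulmxV ?posdef_unitmx// mul1mx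
  frobenius_sq /mxtrace big_ord1.
Qed.

Lemma invmx_form_ge (b : R) :
  0 < b -> (forall x, qform M x x <= b * frobenius x ^+ 2) -> form_ge b^-1 S.
Proof.
move=> b0 h x; have [->|x0] := eqVneq x 0.
  by rewrite frobenius0 expr0n mulr0 invmx_psd.
rewrite ler_pdivrMl//.
have f0 : 0 < frobenius x ^+ 2 by rewrite exprn_gt0// frobenius_gt0.
rewrite -(ler_pM2l f0) -expr2; apply: le_trans (qform_invmx_ge x) _.
rewrite mulrA [_ * b]mulrC; apply: ler_wpM2r => //; exact: invmx_psd.
Qed.

(** With y = S x, both c |y|^2 <= x.S x and (x.S x)^2 <= |x|^2 |y|^2 hold. *)
Lemma invmx_form_le (c : R) :
  0 < c -> form_ge c M -> forall x, qform S x x <= c^-1 * frobenius x ^+ 2.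
Proof.
move=> c0 h x; rewrite ler_pdivlMl//.
have [e|s0] := eqVneq (qform S x x) 0; first by rewrite e mulr0 sqr_ge0.
have sp : 0 < qform S x x by rewrite lt_neqAle eq_sym s0 invmx_psd.
rewrite -(ler_pM2r sp) -mulrA -expr2.
have h1 := h (S *m x); rewrite -qform_invmx in h1.
have := mxtrace_CauchySchwarz x (S *m x).
rewrite mulmxA -qform_tr => /sqr_le_of_norm h2.
have := ler_wpM2l (ltW c0) h2; move/le_trans; apply.
by rewrite exprMn mulrCA ler_wpM2l// sqr_ge0.
Qed.

Lemma invmx_trace_le (c : R) : 0 < c -> form_ge c M -> \tr S <= n%:R / c.
Proof.
move=> c0 h; have -> : n%:R / c = \sum_(i < n) c^-1.
  by rewrite sumr_const card_ord mulr_natl.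
apply: ler_sum => i _; have := invmx_form_le c0 h (delta_mx i 0).
by rewrite qform_delta frobenius_delta expr1n mulr1.
Qed.

(** A bound on the trace of the inverse keeps M away from singularity: it
    bounds the form of S, and qform_invmx_ge transfers the bound to M. *)
Lemma form_ge_of_invmx_trace (t : R) : 0 < t -> \tr S <= t -> form_ge t^-1 M.
Proof.
move=> t0 h x; have [->|x0] := eqVneq x 0.
  by rewrite frobenius0 expr0n mulr0 posdef_psd.
rewrite ler_pdivrMl//.
have f0 : 0 < frobenius x ^+ 2 by rewrite exprn_gt0// frobenius_gt0.
rewrite -(ler_pM2r f0) -expr2; apply: le_trans (qform_invmx_ge x) _.
rewrite mulrAC mulrC; apply: ler_wpM2r; first exact: posdef_psd.
apply: le_trans (qform_le_frobenius _ _) _.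
apply: ler_wpM2r; first exact: sqr_ge0.
apply: le_trans h; apply: psd_frobenius_le_trace; first exact: invmx_posdef_sym.
exact: invmx_psd.
Qed.

End Inverse.

Lemma posdef_form_ge n (M : 'M[R]_n) :
  posdef M -> exists2 c, 0 < c & form_ge c M.
Proof.
move=> pM; have t0 : 0 <= \tr (invmx M).
  by apply: sumr_ge0 => i _; rewrite -qform_delta; exact: invmx_psd.
exists (\tr (invmx M) + 1)^-1; first by rewrite invr_gt0 ltr_wpDl.
by apply: form_ge_of_invmx_trace; rewrite ?ltr_wpDl// lerDl.
Qed.

(** The trace is the sum of the values of the form at the columns of X. *)
Lemma form_ge_trace n k (c : R) (S : 'M[R]_n) (X : 'M[R]_(n, k)) :
  form_ge c S -> c * frobenius X ^+ 2 <= \tr (X^T *m S *m X).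
Proof.
move=> h; have -> : \tr (X^T *m S *m X) = \sum_j qform S (col j X) (col j X).
  apply: eq_bigr => j _; rewrite /qform !mxE; apply: eq_bigr => i _.
  by rewrite !mxE; congr (_ * _); apply: eq_bigr => l _; rewrite !mxE.
rewrite -frobenius_tr frobenius_sqE mulr_sumr; apply: ler_sum => j _.
apply: le_trans (h _); rewrite frobenius_sqE.
suff -> : \sum_i \sum_j0 col j X i j0 ^+ 2 = \sum_j0 X^T j j0 ^+ 2 by [].
by apply: eq_bigr => i _; rewrite big_ord1 !mxE.
Qed.

Lemma form_ge_frobenius n k (c : R) (S : 'M[R]_n) (X : 'M[R]_(n, k)) :
  0 <= c -> form_ge c S -> c * frobenius X <= frobenius (S *m X).
Proof.
move=> c0 h; have [->|X0] := eqVneq X 0.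
  by rewrite frobenius0 mulr0 frobenius_ge0.
have f0 := frobenius_gt0 X0; rewrite -(ler_pM2l f0) mulrCA -expr2.
apply: le_trans (form_ge_trace X h) _; rewrite -mulmxA.
by apply: le_trans (ler_norm _) _; exact: mxtrace_CauchySchwarz.
Qed.

(** The left-over factor S is split as B^T B, which turns the trace into the
    form of S on V B^T; a second use of form_ge_trace bounds |V B^T|^2, the
    trace of the form of S on V. *)
Lemma trace_SVSV_ge n (c : R) (S V : 'M[R]_n) :
  0 < c -> S^T = S -> V^T = V -> form_ge c S ->
  c ^+ 2 * frobenius V ^+ 2 <= \tr (S *m V *m S *m V).
Proof.
move=> c0 sS sV h; have [B eB] := posdef_factor (form_ge_posdef sS c0 h).
have -> : \tr (S *m V *m S *m V) = \tr ((V *m B^T)^T *m S *m (V *m B^T)).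
  rewrite trmx_mul trmxK sV !mulmxA [RHS]mxtrace_mulC !mulmxA -eB.
  by [].
apply: le_trans (form_ge_trace _ h).
rewrite expr2 -mulrA ler_wpM2l ?(ltW c0)// (frobenius_sq (V *m B^T)).
rewrite mxtrace_mulC trmx_mul trmxK sV mulmxA -(mulmxA V B^T B) -eB -{2}sV.
exact: form_ge_trace.
Qed.

(** The trace is the form of S on V S, and |V S| = |S V| >= c |V|. *)
Lemma trace_SVSVS_ge n (c : R) (S V : 'M[R]_n) :
  0 < c -> S^T = S -> V^T = V -> form_ge c S ->
  c ^+ 3 * frobenius V ^+ 2 <= \tr (S *m V *m S *m V *m S).
Proof.
move=> c0 sS sV h.
have -> : \tr (S *m V *m S *m V *m S) = \tr ((V *m S)^T *m S *m (V *m S)).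
  by rewrite trmx_mul sS sV !mulmxA.
apply: le_trans (form_ge_trace _ h).
rewrite exprS -mulrA ler_wpM2l ?(ltW c0)// -exprMn -(frobenius_tr (V *m S)).
rewrite trmx_mul sS sV.
by rewrite ler_pXn2r ?nnegrE ?mulr_ge0 ?frobenius_ge0 ?(ltW c0)//
  form_ge_frobenius// ltW.
Qed.

End PositiveDefinite.

(** * Continuity of matrix operations, and compactness *)

Section Continuity.
Variable R : realType.

Lemma continuous_at_sum (T : topologicalType) (I : Type) (r : seq I)
    (P : pred I) (F : I -> T -> R) (x : T) :
  (forall i, P i -> {for x, continuous (F i)}) ->
  {for x, continuous (fun t => \sum_(i <- r | P i) F i t)}.
Proof. by move=> h; apply: cvg_big => //; exact: add_continuous. Qed.

Lemma continuous_at_prod (T : topologicalType) (I : Type) (r : seq I)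
    (P : pred I) (F : I -> T -> R) (x : T) :
  (forall i, P i -> {for x, continuous (F i)}) ->
  {for x, continuous (fun t => \prod_(i <- r | P i) F i t)}.
Proof. by move=> h; apply: cvg_big => //; exact: mul_continuous. Qed.

(** Stated entry by entry, so that determinants, cofactors and inverses reduce
    to sums and products of real functions. *)
Definition mx_continuous_at (T : topologicalType) m n (F : T -> 'M[R]_(m, n))
  (x : T) := forall i j, {for x, continuous (fun t => F t i j)}.

Lemma mx_continuous_det (T : topologicalType) n (F : T -> 'M[R]_n) (x : T) :
  mx_continuous_at F x -> {for x, continuous (fun t => \det (F t))}.
Proof.
move=> h; apply: continuous_at_sum => s _.
by apply: cvgM; [exact: cvg_cst|apply: continuous_at_prod => i _; exact: h].
Qed.

Lemma mx_continuousM (T : topologicalType) m n k (F : T -> 'M[R]_(m, n))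
    (G : T -> 'M[R]_(n, k)) (x : T) :
  mx_continuous_at F x -> mx_continuous_at G x ->
  mx_continuous_at (fun t => F t *m G t) x.
Proof.
move=> hF hG i j; have -> : (fun t => (F t *m G t) i j) =
    (fun t => \sum_l F t i l * G t l j).
  by apply/funext => t; rewrite mxE.
by apply: continuous_at_sum => l _; apply: cvgM; [exact: hF|exact: hG].
Qed.

Lemma mx_continuous_cst (T : topologicalType) m n (M : 'M[R]_(m, n)) (x : T) :
  mx_continuous_at (fun=> M) x.
Proof. by move=> i j; exact: cvg_cst. Qed.

Lemma mx_continuous_trace (T : topologicalType) n (F : T -> 'M[R]_n) (x : T) :
  mx_continuous_at F x -> {for x, continuous (fun t => \tr (F t))}.
Proof. by move=> h; apply: continuous_at_sum => i _; exact: h. Qed.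

Lemma mx_continuous_adj (T : topologicalType) n (F : T -> 'M[R]_n) (x : T) :
  mx_continuous_at F x -> mx_continuous_at (fun t => \adj (F t)) x.
Proof.
move=> h i j.
have -> : (fun t => (\adj (F t)) i j) = (fun t => cofactor (F t) j i).
  by apply/funext => t; rewrite mxE.
apply: cvgM; first exact: cvg_cst.
apply: (mx_continuous_det (F := fun t => row' j (col' i (F t)))) => k l.
have -> : (fun t => row' j (col' i (F t)) k l) =
    (fun t => F t (lift j k) (lift i l)).
  by apply/funext => t; rewrite !mxE.
exact: h.
Qed.

(** Near x the inverse is the adjugate divided by the determinant, by
    continuity of the latter. *)
Lemma mx_continuous_inv (T : topologicalType) n (F : T -> 'M[R]_n) (x : T) :
  mx_continuous_at F x -> F x \in unitmx ->
  mx_continuous_at (fun t => invmx (F t)) x.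
Proof.
move=> h; rewrite unitmxE unitfE => u i j.
have cdet := mx_continuous_det h.
have cG : (\det (F t))^-1 * (\adj (F t)) i j @[t --> x]
    --> (\det (F x))^-1 * (\adj (F x)) i j.
  by apply: cvgM; [exact: cvgV|exact: mx_continuous_adj].
have e : invmx (F x) i j = (\det (F x))^-1 * (\adj (F x)) i j.
  by rewrite /invmx unitmxE unitfE u !mxE.
rewrite /prop_for /continuous_at e; apply: cvg_trans cG.
have hu : \forall t \near x, \det (F t) != 0.
  exact: cdet _ (open_nbhs_nbhs (conj (@open_neq _ 0) u)).
have hn : {near x, (fun t => (\det (F t))^-1 * (\adj (F t)) i j)
    =1 (fun t => invmx (F t) i j)}.
  by apply: filterS hu => t ut; rewrite /invmx unitmxE unitfE ut !mxE.
exact: near_eq_cvg hn.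
Qed.

Lemma mx_continuous_id m n (x : 'M[R]_(m, n)) : mx_continuous_at id x.
Proof. by move=> i j; exact: coord_continuous. Qed.

Lemma mx_continuous_frobenius (T : topologicalType) m n
    (F : T -> 'M[R]_(m, n)) (x : T) :
  mx_continuous_at F x -> {for x, continuous (fun t => frobenius (F t))}.
Proof.
move=> h; apply: (@continuous_comp _ _ _
  (fun t => \sum_i \sum_j F t i j ^+ 2) (@Num.sqrt R));
  last exact: sqrt_continuous.
apply: continuous_at_sum => i _; apply: continuous_at_sum => j _.
exact: cvgM (h i j) (h i j).
Qed.

Lemma frobenius_continuous m n : continuous (@frobenius R m n).
Proof.
by move=> x; exact: mx_continuous_frobenius (@mx_continuous_id _ _ x).
Qed.

Lemma frobenius_cvg n (x : nat -> 'rV[R]_n) (y : 'rV[R]_n) (u : nat -> R) :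
  (forall k, frobenius (x k - y) <= u k) -> u @ \oo --> (0 : R) ->
  x @ \oo --> y.
Proof.
move=> hx /cvgrPdist_le cu; apply/cvgrPdist_le => e e0.
have := cu e e0; apply: filterS => k; rewrite sub0r normrN => hu.
rewrite /Num.Def.normr /= mx_normrE; apply: bigmax_le; first exact: ltW.
move=> [i j] _; apply: le_trans (frobenius_coord _ _ _) _.
rewrite frobenius_distC; apply: le_trans (hx k) _.
exact: le_trans (ler_norm _) hu.
Qed.

Lemma sphere_compact n : compact [set u : 'rV[R]_n | frobenius u = 1].
Proof.
apply: (@subclosed_compact _ _
  [set v : 'rV[R]_n | forall i, `[(-1 : R), 1]%classic (v ord0 i)]).
- apply: (preimage_closed (f := @frobenius R 1 n) (D := [set 1]));
    last exact: closed_eq.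
  by move=> x _; exact: frobenius_continuous.
- by apply: (@rV_compact R n (fun=> `[(-1 : R), 1]%classic)) => _;
    exact: segment_compact.
- move=> u /= u1 i; rewrite in_itv /= -ler_norml -u1; exact: frobenius_coord.
Qed.

Lemma ge_sup0 (E : set R) (x : R) : 0 <= x -> ubound E x -> sup E <= x.
Proof.
move=> x0 h; have [->|/set0P E0] := eqVneq E set0; first by rewrite sup0.
exact: ge_sup.
Qed.

(** The Rayleigh quotient attains its maximum a on the unit sphere; then
    a I - M is semidefinite and vanishes at the maximizer, which is therefore
    an eigenvector. *)
Lemma rayleigh_max n (M : 'M[R]_n.+1) : M^T = M ->
  exists2 a, eigenvalue M a & forall x, qform M x x <= a * frobenius x ^+ 2.
Proof.
move=> sM; pose g (u : 'rV[R]_n.+1) : R := (u *m M *m u^T) 0 0.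
have gc : continuous g.
  move=> u; suff hT : mx_continuous_at (@trmx R 1 n.+1) u.
    have hM := mx_continuousM (@mx_continuous_id _ _ u)
      (@mx_continuous_cst _ _ _ M u).
    exact: (mx_continuousM hM hT).
  move=> i j; have -> : (fun t : 'rV[R]_n.+1 => t^T i j) = (fun t => t j i).
    by apply/funext => t; rewrite mxE.
  exact: coord_continuous.
have s0 : [set u : 'rV[R]_n.+1 | frobenius u = 1] !=set0.
  by exists (delta_mx 0 0)^T => /=; rewrite frobenius_tr frobenius_delta.
have [u0 /set_mem /= u01 umax] := compact_EVT_max s0 (@sphere_compact _)
  (continuous_subspaceT gc).
pose a := g u0.
have ha x : qform M x x <= a * frobenius x ^+ 2.
  have [->|x0] := eqVneq x 0.
    by rewrite /qform mulmx0 mxE frobenius0 expr0n mulr0.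
  have f0 := frobenius_gt0 x0.
  have := umax ((frobenius x)^-1 *: x^T); rewrite inE /= frobeniusZ.
  rewrite ger0_norm ?invr_ge0 ?frobenius_ge0// frobenius_tr mulVf ?gt_eqF//.
  move=> /(_ erefl); rewrite /g.
  have -> : ((frobenius x)^-1 *: x^T)^T = (frobenius x)^-1 *: x.
    by rewrite linearZ /= trmxK.
  rewrite -scalemxAr -!scalemxAl scalerA mxE -/(qform M x x) -/a -invfM -expr2.
  by rewrite mulrC ler_pdivrMr// exprn_gt0.
exists a => //.
pose N := a%:M - M.
have qN x : qform N x x = a * frobenius x ^+ 2 - qform M x x.
  rewrite /N -qform1 !qform_tr mulmxBr mulmxBl linearB /= -mxtraceZ.
  by rewrite scalemxAl scalemxAr scalemx1.
have sN : N^T = N by rewrite /N linearB /= tr_scalar_mx sM.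
have pN x : 0 <= qform N x x by rewrite qN subr_ge0.
have e : N *m u0^T = 0.
  apply: psd_isotropic => //.
  by rewrite qN frobenius_tr u01 expr1n mulr1 /qform trmxK subrr.
apply/eigenvalueP; exists u0; last first.
  apply/eqP => h; move: u01; rewrite h frobenius0 => /eqP.
  by rewrite eq_sym oner_eq0.
apply/esym/eqP; rewrite -subr_eq0 -mul_mx_scalar -mulmxBr -/N.
by rewrite -[_ *m _]trmxK trmx_mul sN e trmx0.
Qed.

Lemma eigenvalue_le_frobenius n (M : 'M[R]_n) a :
  eigenvalue M a -> a <= frobenius M.
Proof.
move=> /eigenvalueP [v va v0]; have f0 := frobenius_gt0 v0.
rewrite -(@ler_pM2r _ (frobenius v))// (le_trans (ler_norm _))//.
rewrite normrM (ger0_norm (frobenius_ge0 _)) -frobeniusZ -va mulrC.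
exact: frobeniusM.
Qed.

Lemma qform_le_lambda_max n (M : 'M[R]_n) x :
  M^T = M -> qform M x x <= lambda_max M * frobenius x ^+ 2.
Proof.
case: n M x => [|n] M x sM.
  have -> : x = 0 by apply/matrixP => -[].
  by rewrite /qform mulmx0 mxE frobenius0 expr0n mulr0.
have [a ea ha] := rayleigh_max sM; apply: le_trans (ha x) _.
rewrite ler_wpM2r ?sqr_ge0//; apply: ub_le_sup => //.
by exists (frobenius M) => y; exact: eigenvalue_le_frobenius.
Qed.

Lemma lambda_max_le_frobenius n (M : 'M[R]_n) : lambda_max M <= frobenius M.
Proof.
apply: ge_sup0; first exact: frobenius_ge0.
by move=> y; exact: eigenvalue_le_frobenius.
Qed.

End Continuity.

(** * Derivatives along lines *)

Section LineDerivatives.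
Variable R : realType.

Lemma is_derive_line (V : normedModType R) (f : V -> R) (p v : V) (t d : R) :
  is_derive (p + t *: v) v f d <->
  is_derive t (1 : R) (fun s : R => f (p + s *: v)) d.
Proof.
have e : (fun h : R => h^-1 *: ((f \o shift (p + t *: v)) (h *: v)
      - f (p + t *: v))) =
    (fun h : R => h^-1 *: (((fun s : R => f (p + s *: v)) \o shift t) (h *: 1)
      - f (p + t *: v))).
  apply/funext => h /=; congr (_ *: (f _ - _)).
  by rewrite [_%:A]mulr1 scalerDl addrCA.
by split=> -[df <-]; apply: DeriveDef; rewrite /derivable /derive ?e// -?e.
Qed.

Lemma is_derive_line0 (V : normedModType R) (f : V -> R) (p v : V) (d : R) :
  is_derive p v f d <-> is_derive 0 (1 : R) (fun s : R => f (p + s *: v)) d.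
Proof. by rewrite -is_derive_line scale0r addr0. Qed.

Lemma is_derive_of_cvg (V : normedModType R) (f : V -> R) (p v : V) (d : R) :
  h^-1 *: (f (h *: v + p) - f p) @[h --> (0 : R)^'] --> d ->
  is_derive p v f d.
Proof.
by move=> h; apply: DeriveDef; [apply/cvg_ex; exists d|exact: cvg_lim].
Qed.

Lemma horner_char_poly n (A : 'M[R]_n) (a : R) :
  (char_poly A).[a] = \det (a%:M - A).
Proof.
rewrite -horner_evalE -det_map_mx; congr (\det _).
apply/matrixP => i j; rewrite !mxE /= /horner_eval.
by rewrite hornerD hornerN hornerMn hornerX hornerC.
Qed.

(** The determinant along a line is the characteristic polynomial of - N read
    backwards, so its coefficient of degree one is the trace of N. *)
Lemma det_add_line n (N : 'M[R]_n) (h : R) :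
  \det (1%:M + h *: N) = (\poly_(k < n.+1) (char_poly (- N))`_(n - k)).[h].
Proof.
rewrite horner_poly (reindex_inj rev_ord_inj) /=.
have mon : (char_poly (- N))`_n = 1.
  by have /monicP := char_poly_monic (- N); rewrite lead_coefE size_char_poly.
have [->|h0] := eqVneq h 0.
  rewrite scale0r addr0 det1 (bigD1 ord_max) //= big1 ?addr0; last first.
    move=> i; rewrite -val_eqE /= => ine.
    by rewrite expr0n subSS subn_eq0 leqNgt ltn_neqAle ine -ltnS ltn_ord mulr0.
  by rewrite subSS subnn subn0 mon expr0 mulr1.
have -> : 1%:M + h *: N = h *: (h^-1%:M - (- N)).
  by rewrite opprK scalerDr scale_scalar_mx divff.
rewrite detZ -horner_char_poly (@horner_coef_wide _ n.+1) ?size_char_poly//.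
rewrite big_distrr /=; apply: eq_bigr => i _.
have ile : (i <= n)%N by rewrite -ltnS.
rewrite !subSS (subKn ile) mulrCA exprVn; congr (_ * _).
by rewrite -{1}(subnK ile) exprD mulfK// expf_neq0.
Qed.

(** Jacobi's formula. *)
Lemma is_derive_det n (M V : 'M[R]_n) : M \in unitmx ->
  is_derive 0 (1 : R) (fun h : R => \det (M + h *: V))
    (\det M * \tr (invmx M *m V)).
Proof.
move=> uM; set q := \poly_(k < n.+1) (char_poly (- (invmx M *m V)))`_(n - k).
have -> : (fun h : R => \det (M + h *: V)) = \det M \*: horner q.
  apply/funext => h; rewrite /= -det_add_line -[RHS]/(\det M * _).
  rewrite -det_mulmx mulmxDr mulmx1.
  by rewrite -scalemxAr mulKVmx.
apply: is_derive_eq.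
congr (_ * _); rewrite horner_coef0 coef_deriv mulr1n coef_poly.
rewrite ltnS; case: posnP => [n0|n0]; last first.
  by rewrite subn1 char_poly_trace// linearN opprK.
rewrite /mxtrace big1// => i _.
by have := ltn_ord i; rewrite [X in (_ < X)%N]n0.
Qed.

(** The chain rule and Jacobi's formula cancel the determinant. *)
Lemma is_derive_lndet n (M V : 'M[R]_n) : posdef M ->
  is_derive 0 (1 : R) (fun h : R => ln (\det (M + h *: V)))
    (\tr (invmx M *m V)).
Proof.
move=> pM; have d0 := posdef_det_gt0 pM.
have hd := is_derive_det V (posdef_unitmx pM).
have hl : is_derive ((fun h : R => \det (M + h *: V)) 0) (1 : R) (@ln R)
    (\det M)^-1.
  by rewrite scale0r addr0; exact: is_derive1_ln.
by have := is_derive1_comp hl hd; rewrite mulKf ?gt_eqF.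
Qed.

(** Stated entry by entry, so that the rules for real functions apply. *)
Definition mx_is_derive (V : normedModType R) m n (x v : V)
    (F : V -> 'M[R]_(m, n)) (G : 'M[R]_(m, n)) :=
  forall i j, is_derive x v (fun t => F t i j) (G i j).

Lemma mx_is_derive_cst (V : normedModType R) m n (x v : V) (M : 'M[R]_(m, n)) :
  mx_is_derive x v (fun=> M) 0.
Proof. by move=> i j; rewrite mxE; exact: is_derive_cst. Qed.

Lemma mx_is_deriveM (V : normedModType R) m n k (x v : V)
    (F : V -> 'M[R]_(m, n)) (G : V -> 'M[R]_(n, k)) F' G' :
  mx_is_derive x v F F' -> mx_is_derive x v G G' ->
  mx_is_derive x v (fun t => F t *m G t) (F' *m G x + F x *m G').
Proof.
move=> hF hG i j.
have -> : (fun t => (F t *m G t) i j) =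
    \sum_l ((fun t => F t i l) * (fun t => G t l j)).
  by apply/funext => t; rewrite mxE fct_sumE.
apply: is_derive_eq.
  apply: is_derive_sum => l; exact: is_deriveM (hF i l) (hG l j).
rewrite !mxE -big_split /=; apply: eq_bigr => l _.
by rewrite addrC; congr (_ + _); exact: mulrC.
Qed.

Lemma is_derive_trace (V : normedModType R) n (x v : V)
    (F : V -> 'M[R]_n) F' :
  mx_is_derive x v F F' -> is_derive x v (fun t => \tr (F t)) (\tr F').
Proof.
move=> hF; have -> : (fun t => \tr (F t)) = \sum_i (fun t => F t i i).
  by apply/funext => t; rewrite fct_sumE.
by apply: is_derive_sum => i; exact: hF.
Qed.

(** The resolvent identity
    (M + h V)^-1 - M^-1 = - h (M + h V)^-1 V M^-1,
    together with the continuity of the inverse. *)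
Lemma mx_is_derive_inv (V : normedModType R) n (x v : V) (F : V -> 'M[R]_n)
    (W : 'M[R]_n) :
  (forall h, F (h *: v + x) = F x + h *: W) -> F x \in unitmx ->
  mx_is_derive x v (fun t => invmx (F t)) (- (invmx (F x) *m W *m invmx (F x))).
Proof.
move=> hF u i j; apply: is_derive_of_cvg.
pose g (h : R) : 'M[R]_n := F x + h *: W.
have g0 : g 0 = F x by rewrite /g scale0r addr0.
have cg : mx_continuous_at g 0.
  move=> k l; have -> : (fun t => g t k l) = (fun t => F x k l + t * W k l).
    by apply/funext => t; rewrite !mxE.
  by apply: cvgD; [exact: cvg_cst|apply: cvgM; [exact: cvg_id|exact: cvg_cst]].
have cdet := mx_continuous_det cg.
have u0 : \det (g 0) != 0 by rewrite g0 -unitfE -unitmxE.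
have hu : \forall h \near (0 : R), \det (g h) != 0.
  exact: cdet _ (open_nbhs_nbhs (conj (@open_neq _ 0) u0)).
have cS : mx_continuous_at (fun h => - (invmx (g h) *m W *m invmx (F x))) 0.
  have cI : mx_continuous_at (fun h => invmx (g h)) 0.
    by apply: mx_continuous_inv => //; rewrite g0.
  have cW : mx_continuous_at (fun h => invmx (g h) *m W) 0.
    exact: (mx_continuousM cI (@mx_continuous_cst _ _ _ _ W _)).
  have cP : mx_continuous_at (fun h => invmx (g h) *m W *m invmx (F x)) 0.
    exact: (mx_continuousM cW (@mx_continuous_cst _ _ _ _ (invmx (F x)) _)).
  move=> k l.
  have -> : (fun t => (- (invmx (g t) *m W *m invmx (F x))) k l) =
      (fun t => - (invmx (g t) *m W *m invmx (F x)) k l).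
    by apply/funext => t; rewrite mxE.
  by apply: cvgN; exact: cP.
have := (continuous_withinNx _ _).1 (cS i j); rewrite g0.
apply: cvg_trans; apply: near_eq_cvg.
near=> h.
have h0 : h != 0 by near: h; exact: nbhs_dnbhs_neq.
have uh : g h \in unitmx.
  by rewrite unitmxE unitfE; near: h; exact: nbhs_dnbhs hu.
rewrite hF -/(g h).
have e : invmx (g h) - invmx (F x) = - (h *: (invmx (g h) *m W *m invmx (F x))).
  have -> : W = h^-1 *: (g h - F x) by rewrite /g addrAC subrr add0r scalerK.
  rewrite -scalemxAr -scalemxAl scalerA divff// scale1r mulmxBr mulVmx//.
  by rewrite mulmxBl mul1mx mulmxK// opprB.
have -> : (invmx (g h) i j - invmx (F x) i j) = (invmx (g h) - invmx (F x)) i j.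
  by rewrite !mxE.
by rewrite e !mxE scalerN [_ *: _]mulrA mulVf// mul1r.
Unshelve. all: by end_near. Qed.

End LineDerivatives.

(** * Projected gradient steps *)

Section Projection.
Variables (R : realType) (m : nat).
Implicit Types (u v x y p q g : 'rV[R]_m) (C : set 'rV[R]_m).

Lemma dot_tr u v : dot u v = \tr (u^T *m v).
Proof. by rewrite mxtrace_trmul big_ord1. Qed.

Lemma dotC u v : dot u v = dot v u.
Proof. by apply: eq_bigr => i _; rewrite mulrC. Qed.

Lemma dotDr u v w : dot u (v + w) = dot u v + dot u w.
Proof. by rewrite !dot_tr mulmxDr mxtraceD. Qed.

Lemma dotZr u (c : R) v : dot u (c *: v) = c * dot u v.
Proof. by rewrite !dot_tr -scalemxAr mxtraceZ. Qed.

Lemma dotNr u v : dot u (- v) = - dot u v.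
Proof. by rewrite -scaleN1r dotZr mulN1r. Qed.

Lemma dotDl u v w : dot (v + w) u = dot v u + dot w u.
Proof. by rewrite dotC dotDr !(dotC u). Qed.

Lemma dotZl u (c : R) v : dot (c *: v) u = c * dot v u.
Proof. by rewrite dotC dotZr dotC. Qed.

Lemma dotNl u v : dot (- v) u = - dot v u.
Proof. by rewrite dotC dotNr dotC. Qed.

Lemma frobenius_dot u : frobenius u ^+ 2 = dot u u.
Proof. by rewrite frobenius_sq dot_tr. Qed.

Lemma dot_CauchySchwarz u v : `|dot u v| <= frobenius u * frobenius v.
Proof. by rewrite dot_tr; exact: mxtrace_CauchySchwarz. Qed.

Lemma frobenius_sqD u v :
  frobenius (u + v) ^+ 2 = frobenius u ^+ 2 + 2 * dot u v + frobenius v ^+ 2.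
Proof. by rewrite !frobenius_dot dotDr !dotDl (dotC v u); ring. Qed.

Lemma convex_set_segment C x y (t : R) : convex_set C -> C x -> C y ->
  0 <= t <= 1 -> C (x + t *: (y - x)).
Proof.
move=> cC Cx Cy /andP[t0 t1].
have := cC y x (Itv01 t0 t1) (mem_set Cy) (mem_set Cx).
rewrite inE.
have -> : x + t *: (y - x) = t *: y + (1 - t) *: x; last by [].
by rewrite scalerBl scale1r scalerBr addrCA.
Qed.

Variable C : set 'rV[R]_m.
Hypotheses (C0 : C !=set0) (compactC : compact C) (convexC : convex_set C).

Lemma projP x :
  C (Defs.proj C x) /\
  forall y, C y -> frobenius (x - Defs.proj C x) <= frobenius (x - y).
Proof.
have cf : continuous (fun y => frobenius (x - y)).
  move=> y; suff h : mx_continuous_at (fun t : 'rV[R]_m => x - t) y.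
    exact: (mx_continuous_frobenius h).
  move=> i j; have -> : (fun t => (x - t) i j) = (fun t => x i j - t i j).
    by apply/funext => t; rewrite !mxE.
  exact: (cvgB (cvg_cst _) (@coord_continuous R 1 m i j y)).
have [q /set_mem Cq hq] :=
  compact_EVT_min C0 compactC (continuous_subspaceT cf).
rewrite /Defs.proj; apply: (@xgetPex _ 0
  [set q | C q /\ forall y, C y -> frobenius (x - q) <= frobenius (x - y)]).
by exists q; split=> // y Cy; apply: hq; rewrite inE.
Qed.

(** Perturbing the nearest point q towards y by a fraction t of the segment
    changes the squared distance by - 2 t (x - q).(y - q) + O(t^2). *)
Lemma proj_variational x y :
  C y -> dot (x - Defs.proj C x) (y - Defs.proj C x) <= 0.
Proof.
move=> Cy; have [Cq hq] := projP x; set q := Defs.proj C x in Cq hq *.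
rewrite leNgt; apply/negP => d0; set d := dot _ _ in d0.
set N := frobenius (y - q) ^+ 2.
have N0 : 0 <= N by exact: sqr_ge0.
(* any t in (0, 1] with t N < 2 d would do *)
pose t := d / (d + N).
have dN : 0 < d + N by rewrite ltr_wpDr.
have t0 : 0 < t by rewrite divr_gt0.
have t1 : t <= 1 by rewrite ler_pdivrMr// mul1r lerDl.
have t01 : 0 <= t <= 1 by rewrite (ltW t0).
have := hq _ (convex_set_segment convexC Cq Cy t01).
rewrite -(@ler_pXn2r _ 2)// ?nnegrE ?frobenius_ge0//.
have -> : x - (q + t *: (y - q)) = (x - q) + (- t) *: (y - q).
  by rewrite opprD addrA scaleNr.
rewrite (frobenius_sqD (x - q)) dotZr frobeniusZ exprMn real_normK ?num_real//.
rewrite -/d -/N -addrA lerDl sqrrN => h.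
have : 0 <= t * (t * N - 2 * d) by lra.
rewrite pmulr_rge0// => h2.
have : t * N <= d.
  by rewrite /t mulrAC ler_pdivrMr// ler_wpM2l ?(ltW d0)// lerDr ltW.
lra.
Qed.

Variables (f : 'rV[R]_m -> R) (p : 'rV[R]_m) (a : R).
Hypotheses (Cp : C p) (a0 : 0 < a).
Let q := trial f C p a.
Let g := grad f p.

Lemma trial_in : C q.
Proof. exact: (projP _).1. Qed.

Lemma trial_descent : dot g (q - p) <= - (frobenius (q - p) ^+ 2 / a).
Proof.
have := proj_variational (p - a *: g) Cp.
rewrite -/(trial f C p a) -/q.
have -> : p - a *: g - q = - (a *: g + (q - p)).
  by rewrite opprD opprB addrA [- _ + p]addrC.
rewrite -[p - q]opprB dotNr dotNl opprK dotDl dotZl -frobenius_dot => h.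
by rewrite -(ler_pM2l a0) mulrN mulrCA divff ?gt_eqF// mulr1; lra.
Qed.

Lemma trial_dist : frobenius (q - p) <= a * frobenius g.
Proof.
have [->|n0] := eqVneq (frobenius (q - p)) 0.
  by rewrite mulr_ge0 ?(ltW a0) ?frobenius_ge0.
have np : 0 < frobenius (q - p) by rewrite lt_neqAle eq_sym n0 frobenius_ge0.
rewrite -(ler_pM2r np) -expr2.
have h1 := trial_descent.
have h2 : - dot g (q - p) <= frobenius g * frobenius (q - p).
  apply: le_trans (dot_CauchySchwarz _ _).
  by rewrite -normrN; exact: ler_norm.
have : frobenius (q - p) ^+ 2 / a <= frobenius g * frobenius (q - p) by lra.
by rewrite ler_pdivrMr// [X in _ <= X -> _]mulrC mulrA.
Qed.

(** The trial point minimizes over C the model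
    y |-> g.(y - p) + |y - p|^2 / (2 a). *)
Lemma trial_model y : C y ->
  dot g (q - p) + frobenius (q - p) ^+ 2 / (2 * a)
  <= dot g (y - p) + frobenius (y - p) ^+ 2 / (2 * a).
Proof.
move=> Cy; have := (projP (p - a *: g)).2 _ Cy.
rewrite -/(trial f C p a) -/q -(@ler_pXn2r _ 2)// ?nnegrE ?frobenius_ge0//.
have e z : frobenius (p - a *: g - z) ^+ 2 =
    frobenius (a *: g) ^+ 2
    + 2 * a * (dot g (z - p) + frobenius (z - p) ^+ 2 / (2 * a)).
  have -> : p - a *: g - z = - (a *: g + (z - p)).
    by rewrite opprD opprB addrA [- _ + p]addrC.
  by rewrite frobeniusN frobenius_sqD dotZl; field; rewrite gt_eqF.
by rewrite !e lerD2l ler_pM2l// mulr_gt0.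
Qed.

(** Comparing q with the points of the segment from p to ps: at the fraction
    t = min 1 (mu a), the quadratic term of the model is absorbed by strong
    convexity. *)
Lemma trial_gap (mu : R) (ps : 'rV[R]_m) : C ps -> 0 <= mu ->
  f p + dot g (ps - p) + mu / 2 * frobenius (ps - p) ^+ 2 <= f ps ->
  dot g (q - p) <= - (Num.min 1 (mu * a) * (f p - f ps)).
Proof.
move=> Cps mu0 sc; set t := Num.min 1 _.
have t0 : 0 <= t by rewrite le_min ler01 mulr_ge0// ltW.
have t1 : t <= 1 by rewrite ge_min lexx.
have tm : t <= mu * a by rewrite ge_min lexx orbT.
have t01 : 0 <= t <= 1 by rewrite t0.
have := trial_model (convex_set_segment convexC Cp Cps t01).
rewrite addrAC subrr add0r dotZr frobeniusZ exprMn real_normK ?num_real//.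
set N := frobenius (ps - p) ^+ 2 in sc *.
have N0 : 0 <= N by exact: sqr_ge0.
have q0 : 0 <= frobenius (q - p) ^+ 2 / (2 * a).
  by rewrite divr_ge0 ?sqr_ge0// mulr_ge0// ltW.
have h1 : t ^+ 2 * N / (2 * a) <= t * (mu / 2 * N).
  rewrite ler_pdivrMr ?mulr_gt0//.
  have -> : t * (mu / 2 * N) * (2 * a) = t * (mu * a * N) by field.
  by rewrite expr2 -mulrA ler_wpM2l// ler_wpM2r.
have h2 := ler_wpM2l t0 sc.
lra.
Qed.

End Projection.

(** * Second-order expansions *)

Section Taylor.
Variable R : realType.

(** The mean value theorem, applied to h1 and then to h minus the quadratic
    polynomial h1 0 t + K t^2 / 2. *)
Lemma taylor2_le (h h1 h2 : R -> R) (K : R) :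
  (forall t : R, 0 <= t <= 1 -> is_derive t (1 : R) h (h1 t)) ->
  (forall t : R, 0 <= t <= 1 -> is_derive t (1 : R) h1 (h2 t)) ->
  (forall t : R, 0 <= t <= 1 -> h2 t <= K) ->
  h 1 <= h 0 + h1 0 + K / 2.
Proof.
move=> d1 d2 hK.
have cont (F F' : R -> R) (s : R) : s <= 1 ->
    (forall t : R, 0 <= t <= 1 -> is_derive t (1 : R) F (F' t)) ->
    {within `[0, s], continuous F}.
  move=> s1 dF; apply: derivable_within_continuous => t.
  rewrite in_itv /= => /andP[t0 ts].
  have t01 : 0 <= t <= 1 by rewrite t0 (le_trans ts).
  by have [] := dF t t01.
have b1 (t : R) : 0 <= t <= 1 -> h1 t <= h1 0 + K * t.
  move=> /andP[t0 t1].
  have dd (x : R) : x \in `]0, t[%R -> is_derive x (1 : R) h1 (h2 x).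
    by rewrite in_itv /= => /andP[x0 xt]; apply: d2;
      rewrite ltW//= (le_trans (ltW xt)).
  have [c] := MVT_segment t0 dd (cont _ _ _ t1 d2).
  rewrite in_itv /= subr0 => /andP[c0 ct] e.
  rewrite -lerBlDl e ler_wpM2r//; apply: hK.
  by rewrite c0 (le_trans ct).
pose phi : R -> R := fun t => h t - (h1 0 * t + K / 2 * t ^+ 2).
pose phi1 : R -> R := fun t => h1 t - (h1 0 + K * t).
have dphi (t : R) : 0 <= t <= 1 -> is_derive t (1 : R) phi (phi1 t).
  move=> t01; pose P : {poly R} := h1 0 *: 'X + (K / 2) *: 'X^2.
  have -> : phi = h - horner P.
    by apply/funext => s; rewrite /phi /P !fctE !hornerE.
  apply: is_derive_eq; first exact: is_deriveB (d1 t t01) (is_derive_poly _ _).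
  rewrite /phi1 /P derivD !derivZ derivX derivXn !hornerE /=.
by field.
have dd (x : R) : x \in `]0, 1[%R -> is_derive x (1 : R) phi (phi1 x).
  by rewrite in_itv /= => /andP[x0 x1]; apply: dphi; rewrite !ltW.
have [c] := MVT_segment ler01 dd (cont _ _ _ (lexx 1) dphi).
rewrite in_itv /= subr0 mulr1 => c01 e.
have : phi 1 - phi 0 <= 0 by rewrite e subr_le0; exact: b1.
rewrite /phi; lra.
Qed.

Lemma taylor2_ge (h h1 h2 : R -> R) (K : R) :
  (forall t : R, 0 <= t <= 1 -> is_derive t (1 : R) h (h1 t)) ->
  (forall t : R, 0 <= t <= 1 -> is_derive t (1 : R) h1 (h2 t)) ->
  (forall t : R, 0 <= t <= 1 -> K <= h2 t) ->
  h 0 + h1 0 + K / 2 <= h 1.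
Proof.
move=> d1 d2 hK.
have := @taylor2_le (- h) (- h1) (- h2) (- K).
have -> : (- h) 1 = - h 1 by [].
have -> : (- h) 0 = - h 0 by [].
have -> : (- h1) 0 = - h1 0 by [].
have e : - h 1 <= - h 0 - h1 0 - K / 2 -> h 0 + h1 0 + K / 2 <= h 1 by lra.
rewrite -mulNr in e; move=> H; apply: e; apply: H => t t01.
- exact: is_deriveN (d1 t t01).
- exact: is_deriveN (d2 t t01).
- by rewrite lerN2 hK.
Qed.

(** Directional derivatives suffice: the gradient and the Hessian consist of
    partial derivatives, the expansions are taken along segments, and the last
    two fields (linearity of D1 p, bilinearity of D2 p) connect the two. *)
Record C2_data (m : nat) (U : set 'rV[R]_m) (f : 'rV[R]_m -> R)
    (D1 : 'rV[R]_m -> 'rV[R]_m -> R)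
    (D2 : 'rV[R]_m -> 'rV[R]_m -> 'rV[R]_m -> R) : Prop := {
  C2_open : forall p, U p -> \forall q \near p, U q;
  C2_D1 : forall p v, U p -> is_derive p v f (D1 p v);
  C2_D2 : forall p v w, U p -> is_derive p v (fun q => D1 q w) (D2 p v w);
  C2_D1_sum : forall p v, D1 p v = \sum_i v 0 i * D1 p (delta_mx 0 i);
  C2_D2_sum : forall p v w, D2 p v w =
    \sum_i \sum_j v 0 i * w 0 j * D2 p (delta_mx 0 i) (delta_mx 0 j)
}.

Section C2.
Variables (m : nat) (U : set 'rV[R]_m) (f : 'rV[R]_m -> R).
Variables (D1 : 'rV[R]_m -> 'rV[R]_m -> R).
Variables (D2 : 'rV[R]_m -> 'rV[R]_m -> 'rV[R]_m -> R).
Hypothesis fC2 : C2_data U f D1 D2.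

Lemma dot_grad p v : U p -> dot (grad f p) v = D1 p v.
Proof.
move=> Up; rewrite (C2_D1_sum fC2); apply: eq_bigr => i _.
have d := C2_D1 fC2 (delta_mx 0 i) Up.
by rewrite mxE derive_val mulrC.
Qed.

(** Openness of U lets the partial derivatives of f be replaced by D1 near
    p before they are differentiated. *)
Lemma hessianE p i j : U p ->
  hessian f p i j = D2 p (delta_mx 0 i) (delta_mx 0 j).
Proof.
move=> Up; rewrite mxE.
have -> : 'D_(delta_mx 0 i) ('D_(delta_mx 0 j) f) p
    = 'D_(delta_mx 0 i) (fun q => D1 q (delta_mx 0 j)) p.
  apply: near_eq_derive; apply: filterS (C2_open fC2 Up) => q Uq.
  have d := C2_D1 fC2 (delta_mx 0 j) Uq; exact: derive_val.
have d := C2_D2 fC2 (delta_mx 0 i) (delta_mx 0 j) Up; exact: derive_val.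
Qed.

Lemma qform_hessian p v : U p ->
  D2 p v v = qform (hessian f p) v^T v^T.
Proof.
move=> Up; rewrite (C2_D2_sum fC2) qform_tr trmxK -mulmxA.
rewrite -[X in \tr (X *m _)]trmxK mxtrace_trmul.
apply: eq_bigr => i _; rewrite big_ord1 !mxE mulr_sumr.
by apply: eq_bigr => j _; rewrite hessianE// mxE; ring.
Qed.

Let line (p q : 'rV[R]_m) (t : R) := p + t *: (q - p).

Lemma C2_taylor_le p q (K : R) :
  (forall t : R, 0 <= t <= 1 -> U (line p q t)) ->
  (forall t : R, 0 <= t <= 1 -> D2 (line p q t) (q - p) (q - p) <= K) ->
  f q <= f p + dot (grad f p) (q - p) + K / 2.
Proof.
move=> hU hK; have Up : U p.
  by have := hU 0; rewrite /line scale0r addr0 lexx ler01; apply.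
rewrite dot_grad//.
have := @taylor2_le (fun t => f (line p q t))
  (fun t => D1 (line p q t) (q - p))
  (fun t => D2 (line p q t) (q - p) (q - p)) K.
rewrite /line scale0r addr0 scale1r subrKC; apply => [t t01|t t01|];
  last exact: hK.
- exact: (is_derive_line f p (q - p) t _).1 (C2_D1 fC2 (q - p) (hU t t01)).
- exact: (is_derive_line (fun z => D1 z (q - p)) p (q - p) t _).1
    (C2_D2 fC2 (q - p) (q - p) (hU t t01)).
Qed.

Lemma C2_taylor_ge p q (K : R) :
  (forall t : R, 0 <= t <= 1 -> U (line p q t)) ->
  (forall t : R, 0 <= t <= 1 -> K <= D2 (line p q t) (q - p) (q - p)) ->
  f p + dot (grad f p) (q - p) + K / 2 <= f q.
Proof.
move=> hU hK; have Up : U p.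
  by have := hU 0; rewrite /line scale0r addr0 lexx ler01; apply.
rewrite dot_grad//.
have := @taylor2_ge (fun t => f (line p q t))
  (fun t => D1 (line p q t) (q - p))
  (fun t => D2 (line p q t) (q - p) (q - p)) K.
rewrite /line scale0r addr0 scale1r subrKC; apply => [t t01|t t01|];
  last exact: hK.
- exact: (is_derive_line f p (q - p) t _).1 (C2_D1 fC2 (q - p) (hU t t01)).
- exact: (is_derive_line (fun z => D1 z (q - p)) p (q - p) t _).1
    (C2_D2 fC2 (q - p) (q - p) (hU t t01)).
Qed.

End C2.
End Taylor.

(** * Step sizes accepted by the line search *)

Section Distance.
Variables (R : realType) (m : nat).
Implicit Types (X Y U C : set 'rV[R]_m) (p q : 'rV[R]_m).

Lemma dist_le X Y p q : X p -> Y q -> dist X Y <= frobenius (p - q).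
Proof.
move=> Xp Yq; apply: ge_inf; last by exists p => //; exists q.
by exists 0 => _ [x _ [y _ <-]]; exact: frobenius_ge0.
Qed.

Lemma dist_ge X Y (c : R) : X !=set0 -> Y !=set0 ->
  (forall p q, X p -> Y q -> c <= frobenius (p - q)) -> c <= dist X Y.
Proof.
move=> [x Xx] [y Yy] h; apply: lb_le_inf.
  by exists (frobenius (x - y)); exists x => //; exists y.
by move=> _ [p Xp [q Yq <-]]; exact: h.
Qed.

Lemma dist_lt X Y (c : R) : X !=set0 -> Y !=set0 -> dist X Y < c ->
  exists p q, [/\ X p, Y q & frobenius (p - q) < c].
Proof.
move=> [x Xx] [y Yy] h; have [|_ [p Xp [q Yq <-]] lt] := inf_lt _ h.
  by exists (frobenius (x - y)); exists x => //; exists y.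
by exists p, q.
Qed.

(** A point outside U would realize a smaller distance. *)
Lemma dist_compl_in X U p q : X p -> frobenius (q - p) < dist X (~` U) -> U q.
Proof.
move=> Xp h; apply: contrapT => nU.
by have := lt_le_trans h (dist_le Xp nU); rewrite frobenius_distC ltxx.
Qed.

Lemma spectral_norm_ub n (M : 'M[R]_n) : has_ubound
  [set frobenius (M *m x) | x in [set x : 'cV[R]_n | frobenius x = 1]].
Proof.
exists (frobenius M) => _ [x /= x1 <-].
by apply: le_trans (frobeniusM _ _) _; rewrite x1 mulr1.
Qed.

Lemma spectral_norm_le_frobenius n (M : 'M[R]_n) :
  spectral_norm M <= frobenius M.
Proof.
apply: ge_sup0; first exact: frobenius_ge0.
move=> _ [x /= x1 <-].
by apply: le_trans (frobeniusM _ _) _; rewrite x1 mulr1.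
Qed.

Lemma qform_le_spectral n (M : 'M[R]_n) (x : 'cV[R]_n) :
  qform M x x <= spectral_norm M * frobenius x ^+ 2.
Proof.
have [->|x0] := eqVneq x 0.
  by rewrite /qform mulmx0 mxE frobenius0 expr0n mulr0.
have f0 := frobenius_gt0 x0.
have h : frobenius (M *m x) <= spectral_norm M * frobenius x.
  rewrite -ler_pdivrMr// mulrC.
  rewrite -[(frobenius x)^-1]ger0_norm ?invr_ge0 ?(ltW f0)//.
  rewrite -frobeniusZ scalemxAr.
  apply: ub_le_sup; first exact: spectral_norm_ub.
  exists ((frobenius x)^-1 *: x) => //=.
  by rewrite frobeniusZ ger0_norm ?invr_ge0 ?(ltW f0)// mulVf ?gt_eqF.
rewrite qform_tr -mulmxA; apply: le_trans (ler_norm _) _.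
apply: le_trans (mxtrace_CauchySchwarz _ _) _.
by rewrite mulrC expr2 mulrA ler_wpM2r ?frobenius_ge0.
Qed.

End Distance.

Section LineSearch.
Variables (R : realType) (m : nat) (f : 'rV[R]_m -> R).
Variables (C U : set 'rV[R]_m) (p0 : 'rV[R]_m).
Variables (D1 : 'rV[R]_m -> 'rV[R]_m -> R).
Variables (D2 : 'rV[R]_m -> 'rV[R]_m -> 'rV[R]_m -> R).
Hypothesis fC2 : C2_data U f D1 D2.
Hypotheses (C0 : C !=set0) (compactC : compact C) (convexC : convex_set C).
Let F0 := sublevel f C U p0.
Let r := nbhd_radius f C U p0.
Hypothesis d0 : 0 < dist F0 (~` U).
Hypothesis F00 : F0 !=set0.

Lemma nbhd_radius_gt0 : 0 < r.
Proof. by rewrite lt_min ltr01 divr_gt0. Qed.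

Lemma neighborhood_near p q :
  F0 p -> frobenius (q - p) <= r -> neighborhood f C U p0 q.
Proof. by move=> Fp; apply: le_trans; apply: dist_le. Qed.

Lemma neighborhood_close q : neighborhood f C U p0 q ->
  exists2 p, F0 p & frobenius (q - p) < 3 / 4 * dist F0 (~` U).
Proof.
move=> hq; have lt : dist [set q] F0 < 3 / 4 * dist F0 (~` U).
  apply: le_lt_trans hq _; apply: (@le_lt_trans _ _ (dist F0 (~` U) / 2)).
    by rewrite /nbhd_radius ge_min lexx orbT.
  by rewrite mulrC ltr_pM2r//; lra.
have q1 : [set q] !=set0 by exists q.
by have [_ [p [-> Fp h]]] := dist_lt q1 F00 lt; exists p.
Qed.

Lemma neighborhood_sub : neighborhood f C U p0 `<=` U.
Proof.
move=> q /neighborhood_close [p Fp h]; apply: (dist_compl_in Fp).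
by apply: lt_trans h _; rewrite gtr_pMl//; lra.
Qed.

Variables (G H : R).
Hypothesis gradG : forall p, F0 p -> frobenius (grad f p) <= G.
Hypothesis hessH : forall q, neighborhood f C U p0 q ->
  frobenius (hessian f q) <= H.

Lemma grad_boundP p : F0 p -> frobenius (grad f p) <= grad_bound f C U p0.
Proof.
move=> Fp; rewrite /grad_bound le_max; apply/orP; right.
by apply: ub_le_sup; [exists G => _ [x Fx <-]; exact: gradG|exists p].
Qed.

(** The bound H makes the set of spectral norms bounded, so that its supremum
    is a genuine upper bound. *)
Lemma hess_boundP q v : neighborhood f C U p0 q ->
  D2 q v v <= hess_bound f C U p0 * frobenius v ^+ 2.
Proof.
move=> Nq; rewrite (qform_hessian fC2); last exact: neighborhood_sub.
apply: le_trans (qform_le_spectral _ _) _; rewrite frobenius_tr.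
rewrite ler_wpM2r ?sqr_ge0// /hess_bound le_max; apply/orP; right.
apply: ub_le_sup; last by exists q.
exists H => _ [x Nx <-]; apply: le_trans (spectral_norm_le_frobenius _) _.
exact: hessH.
Qed.

Lemma alpha_star_gt0 (sigma : R) : sigma < 1 -> 0 < alpha_star f C U p0 sigma.
Proof.
move=> s1; rewrite /alpha_star lt_min; apply/andP; split; apply: divr_gt0.
- exact: nbhd_radius_gt0.
- by rewrite lt_max ltr01.
- by rewrite mulr_gt0// subr_gt0.
- by rewrite lt_max ltr01.
Qed.

(** For a <= r / G the whole segment from p to the trial point stays in the
    neighborhood, where the second derivative is at most L; for
    a <= 2 (1 - sigma) / L the quadratic term is then compensated by the
    decrease - |q - p|^2 / a of the linear one. *)
Lemma armijo_accept (sigma a : R) p : sigma < 1 -> F0 p ->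
  0 < a <= alpha_star f C U p0 sigma -> armijo f C U sigma p a.
Proof.
move=> s1 Fp /andP[a0]; rewrite le_min => /andP[aG aL].
have [Cp Up fp] := Fp.
have G0 : 0 < grad_bound f C U p0 by rewrite lt_max ltr01.
have L0 : 0 < hess_bound f C U p0 by rewrite lt_max ltr01.
set L := hess_bound f C U p0 in aL L0.
set q := trial f C p a.
have qr : frobenius (q - p) <= r.
  apply: le_trans (trial_dist C0 compactC convexC f Cp a0) _.
  move: aG; rewrite ler_pdivlMr// => aG; apply: le_trans aG.
  by rewrite ler_wpM2l ?(ltW a0)// grad_boundP.
have hN (t : R) : 0 <= t <= 1 -> neighborhood f C U p0 (p + t *: (q - p)).
  move=> /andP[t0 t1]; apply: (neighborhood_near Fp).
  rewrite addrAC subrr add0r frobeniusZ ger0_norm//.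
  by apply: le_trans qr; rewrite ler_piMl ?frobenius_ge0.
have hU (t : R) : 0 <= t <= 1 -> U (p + t *: (q - p)).
  by move=> t01; apply: neighborhood_sub; exact: hN.
have Uq : U q by have := hU 1; rewrite scale1r subrKC lexx ler01; apply.
split=> //; rewrite -/q.
have := C2_taylor_le fC2 hU (fun t t01 => hess_boundP (q - p) (hN t t01)).
rewrite -/L; have := trial_descent C0 compactC convexC f Cp a0; rewrite -/q.
set D := dot _ _; set N := frobenius _ ^+ 2 => h1 h2.
have N0 : 0 <= N by exact: sqr_ge0.
apply: le_trans h2 _; rewrite -addrA lerD2l.
have h3 : L * N / 2 <= (1 - sigma) * (N / a).
  move: aL; rewrite ler_pdivlMr// => aL.
  have NA0 : 0 <= N / a by rewrite divr_ge0// ltW.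
  have -> : L * N / 2 = a * L * (N / a) / 2 by field; rewrite gt_eqF.
  have := ler_wpM2r NA0 aL; lra.
have := ler_wpM2l (ltW (_ : 0 < 1 - sigma)) h1; rewrite subr_gt0 => /(_ s1).
lra.
Qed.

End LineSearch.

(** * Linear convergence under strong convexity *)

Section Convergence.
Variables (R : realType) (m : nat) (f : 'rV[R]_m -> R).
Variables (C U : set 'rV[R]_m) (p0 ps : 'rV[R]_m).
Variables (abar sigma rho mu : R).
Hypotheses (C0 : C !=set0) (compactC : compact C) (convexC : convex_set C).
Hypothesis convexCU : forall p q (t : R), (C `&` U) p -> (C `&` U) q ->
  0 <= t <= 1 -> (C `&` U) (p + t *: (q - p)).
Hypothesis mu0 : 0 < mu.
Hypothesis strong_convexity : forall p q, (C `&` U) p -> (C `&` U) q ->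
  f p + dot (grad f p) (q - p) + mu / 2 * frobenius (q - p) ^+ 2 <= f q.
Hypothesis opt : is_optimal f (C `&` U) ps.

(** Strong convexity between the minimizer ps, the point p and the point z at
    the fraction t of the segment from ps to p bounds f p - f ps from below by
    mu / 2 (1 - t) |p - ps|^2; let t tend to 0. *)
Lemma quadratic_growth p : (C `&` U) p ->
  mu / 2 * frobenius (p - ps) ^+ 2 <= f p - f ps.
Proof.
move=> CUp; have [CUs hs] := opt; set N := frobenius _ ^+ 2.
have N0 : 0 <= N by exact: sqr_ge0.
have key (t : R) : 0 < t -> t < 1 -> mu / 2 * (1 - t) * N <= f p - f ps.
  move=> t0 t1; pose z := ps + t *: (p - ps).
  have CUz : (C `&` U) z by apply: convexCU => //; rewrite !ltW.
  have h1 := strong_convexity CUz CUp; have h2 := strong_convexity CUz CUs.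
  have h3 := hs _ CUz.
  have e1 : p - z = (1 - t) *: (p - ps).
    by rewrite /z opprD addrA scalerBl scale1r.
  have e2 : ps - z = (- t) *: (p - ps).
    by rewrite /z opprD addrA subrr add0r scaleNr.
  rewrite e1 dotZr frobeniusZ exprMn real_normK ?num_real// -/N in h1.
  rewrite e2 dotZr frobeniusZ exprMn real_normK ?num_real// -/N in h2.
  set D := dot _ _ in h1 h2.
  have t10 : 0 <= 1 - t by rewrite subr_ge0 ltW.
  have h1' := ler_wpM2l (ltW t0) h1; have h2' := ler_wpM2l t10 h2.
  have h4 : 0 <= t * (f p - f ps - mu / 2 * (1 - t) * N) by nra.
  by rewrite pmulr_rge0// subr_ge0 in h4.
rewrite leNgt; apply/negP => lt.
set M := mu / 2 * N in lt; set e := f p - f ps in lt key.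
have e0 : 0 <= e by rewrite subr_ge0; exact: hs.
have M0 : 0 < M by exact: le_lt_trans lt.
have t0 : 0 < (M - e) / (2 * M) by rewrite divr_gt0 ?subr_gt0// mulr_gt0.
have t1 : (M - e) / (2 * M) < 1 by rewrite ltr_pdivrMr ?(mulr_gt0 _ M0)//; lra.
have := key _ t0 t1.
have -> : mu / 2 * (1 - (M - e) / (2 * M)) * N = (M + e) / 2.
  have -> : mu / 2 * (1 - (M - e) / (2 * M)) * N = M * (1 - (M - e) / (2 * M)).
    by rewrite /M; ring.
  by field; rewrite gt_eqF.
lra.
Qed.

Lemma optimal_unique p : (C `&` U) p -> f p <= f ps -> p = ps.
Proof.
move=> CUp le; have h := quadratic_growth CUp.
have N0 : frobenius (p - ps) ^+ 2 <= 0.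
  rewrite -(@pmulr_rle0 _ (mu / 2)) ?divr_gt0//.
  by apply: le_trans h _; rewrite subr_le0.
apply/eqP; rewrite -subr_eq0; apply/eqP/frobenius_eq0/eqP.
by rewrite -sqrf_eq0 eq_le N0 sqr_ge0.
Qed.

Hypothesis CUp0 : (C `&` U) p0.
Hypotheses (abar0 : 0 < abar) (sigma01 : 0 < sigma < 1) (rho01 : 0 < rho < 1).
Let astar := alpha_star f C U p0 sigma.
Let alow := alpha_low f C U p0 abar sigma rho.
Let gamma := 1 - sigma * Num.min 1 (mu * alow).
Let F0 := sublevel f C U p0.
Hypothesis astar0 : 0 < astar.
Hypothesis accept : forall p a, F0 p -> 0 < a <= astar ->
  armijo f C U sigma p a.

Lemma alpha_low_gt0 : 0 < alow.
Proof.
by have /andP[r0 _] := rho01; rewrite /alow lt_min abar0 mulr_gt0.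
Qed.

Lemma gamma_in01 : 0 < gamma < 1.
Proof.
have /andP[s0 s1] := sigma01; rewrite /gamma; set t := Num.min _ _.
have t0 : 0 < t by rewrite lt_min ltr01 mulr_gt0// alpha_low_gt0.
have t1 : t <= 1 by rewrite ge_min lexx.
rewrite gtrBl mulr_gt0// andbT subr_gt0.
by apply: le_lt_trans s1; rewrite ler_piMr// ltW.
Qed.

(** The powers of rho eventually bring the step below astar; the first
    accepted one is the least accepted exponent. *)
Lemma backtrack_halts p : F0 p -> exists a, backtrack f C U abar sigma rho p a.
Proof.
move=> Fp; have /andP[r0 r1] := rho01.
have ex : exists j, `[< armijo f C U sigma p (rho ^+ j * abar) >].
  have cv : rho ^+ n @[n --> \oo] --> (0 : R).
    by apply: cvg_expr; rewrite ger0_norm ?ltW.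
  have e0 : 0 < astar / abar by rewrite divr_gt0.
  have [j _ hj] := (cvgrPdist_le _ _).1 cv _ e0.
  exists j; apply/asboolP; apply: accept => //.
  rewrite mulr_gt0 ?exprn_gt0//= -ler_pdivlMr//.
  have := hj j (leqnn j); rewrite /= sub0r normrN.
  exact: le_trans (ler_norm _).
case: (ex_minnP ex) => j /asboolP hj hmin.
exists (rho ^+ j * abar), j; split=> // i ij /asboolP hi.
by have := hmin _ hi; rewrite leqNgt ij.
Qed.

(** If the accepted step is not the first one tried, the step before it was
    rejected, hence exceeds astar. *)
Lemma backtrack_step p a : F0 p -> backtrack f C U abar sigma rho p a ->
  [/\ 0 < a, alow <= a & armijo f C U sigma p a].
Proof.
move=> Fp [j [-> hj hi]]; have /andP[r0 r1] := rho01.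
split=> //; first by rewrite mulr_gt0// exprn_gt0.
rewrite /alow; case: j hj hi => [|j] hj hi.
  by rewrite expr0 mul1r ge_min lexx.
rewrite ge_min; apply/orP; right; rewrite exprS -mulrA ler_pM2l//.
rewrite leNgt; apply/negP => lt; apply: (hi j (ltnSn j)).
apply: (accept Fp); apply/andP; split; last exact: ltW.
by rewrite mulr_gt0// exprn_gt0.
Qed.

(** The Armijo inequality turns the bound of trial_gap into a decrease of f by
    at least sigma min (1, mu a) times the gap. *)
Lemma step_contracts p a : F0 p -> backtrack f C U abar sigma rho p a ->
  let q := trial f C p a in
  F0 q /\ f q - f ps <= gamma * (f p - f ps).
Proof.
move=> Fp /(backtrack_step Fp) [a0 la [Uq arm]] q.
have [Cp Up fp] := Fp; have [[Cs Us] hs] := opt.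
have /andP[s0 s1] := sigma01.
have sc : f p + dot (grad f p) (ps - p) + mu / 2 * frobenius (ps - p) ^+ 2
    <= f ps by apply: strong_convexity.
have gap := trial_gap C0 compactC convexC Cp a0 Cs (ltW mu0) sc.
rewrite -/q in gap Uq arm.
have E0 : 0 <= f p - f ps by rewrite subr_ge0; exact: hs.
have tt : Num.min 1 (mu * alow) <= Num.min 1 (mu * a).
  by rewrite le_min ge_min lexx /= ge_min ler_pM2l// la orbT.
have contr : f q - f ps <= gamma * (f p - f ps).
  have h1 := ler_wpM2r E0 tt.
  have h2 : dot (grad f p) (q - p) <= - (Num.min 1 (mu * alow) * (f p - f ps)).
    by apply: le_trans gap _; rewrite lerN2.
  have h3 := ler_wpM2l (ltW s0) h2.
  rewrite /gamma; lra.
have Cq : C q by rewrite /q; exact: trial_in.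
split=> //; split=> //.
have /andP[_ g1] := gamma_in01.
have : gamma * (f p - f ps) <= f p - f ps by rewrite ler_piMl// ltW.
lra.
Qed.

Lemma iterate_contracts k p : iterate f C U abar sigma rho 0 p0 k p ->
  F0 p /\ f p - f ps <= gamma ^+ k * (f p0 - f ps).
Proof.
elim=> [|{}k {}p a _ [Fp IH] bt _].
  by case: CUp0 => Cp Up; split; [split|rewrite expr0 mul1r].
have [Fq h] := step_contracts Fp bt; split=> //; apply: le_trans h _.
by rewrite exprS -mulrA ler_pM2l//; have /andP[] := gamma_in01.
Qed.

Lemma iterate_linear_rate k p : iterate f C U abar sigma rho 0 p0 k p ->
  frobenius (p - ps)
    <= Num.sqrt (2 * (f p0 - f ps) / mu) * gamma `^ (k%:R / 2).
Proof.
move=> /iterate_contracts [[Cp Up _] h].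
have /andP[g0 g1] := gamma_in01.
rewrite powRrM powR_mulrn ?(ltW g0)// powR12_sqrt ?exprn_ge0 ?(ltW g0)//.
rewrite -sqrtrM; last first.
  rewrite divr_ge0 ?(ltW mu0)// mulr_ge0// subr_ge0; exact: opt.2.
rewrite -[frobenius _]ger0_norm ?frobenius_ge0// -sqrtr_sqr.
rewrite ler_sqrt; last first.
  apply: mulr_ge0; last by rewrite exprn_ge0// ltW.
  rewrite divr_ge0 ?(ltW mu0)// mulr_ge0// subr_ge0; exact: opt.2.
have q := quadratic_growth (conj Cp Up).
rewrite mulrAC ler_pdivlMr// mulrC.
have := le_trans q h; lra.
Qed.

(** With tolerance zero the method stops at a point fixed by the step, where
    the contraction of the gap forces the gap to vanish. *)
Lemma terminates_at_optimum p :
  terminates_at f C U abar sigma rho 0 p0 p -> p = ps.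
Proof.
move=> [k [a [/iterate_contracts [Fp _] bt st]]].
have [a0 _ _] := backtrack_step Fp bt.
have e : trial f C p a = p.
  apply/eqP; rewrite -subr_eq0; apply/eqP/frobenius_eq0/eqP.
  by rewrite eq_le frobenius_ge0 andbT; rewrite ler_pdivrMr// mul0r in st.
have [_] := step_contracts Fp bt; rewrite e => h.
have [Cp Up _] := Fp; apply: optimal_unique => //.
have /andP[g0 g1] := gamma_in01.
rewrite -subr_le0 -(@pmulr_rle0 _ (1 - gamma)) ?subr_gt0//.
by rewrite mulrBl mul1r subr_le0.
Qed.

Lemma terminates_or_converges :
  terminates_at f C U abar sigma rho 0 p0 ps \/
  exists x : nat -> 'rV[R]_m,
    runs_forever f C U abar sigma rho 0 p0 x /\ x @ \oo --> ps.
Proof.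
have [[p tp]|nt] :=
  pselect (exists p, terminates_at f C U abar sigma rho 0 p0 p).
  by left; have e := terminates_at_optimum tp; rewrite e in tp.
right; have ex k : exists p, iterate f C U abar sigma rho 0 p0 k p.
  elim: k => [|k [p ip]]; first by exists p0; exact: iterate_start.
  have [Fp _] := iterate_contracts ip; have [a bt] := backtrack_halts Fp.
  exists (trial f C p a); apply: (iterate_next ip bt) => st.
  by apply: nt; exists p, k, a.
have [x hx] := choice ex; exists x; split=> //.
apply: (frobenius_cvg (fun k => iterate_linear_rate (hx k))).
have /andP[g0 g1] := gamma_in01.
rewrite -[X in _ --> X](mulr0 (Num.sqrt (2 * (f p0 - f ps) / mu))).
apply: cvgM; first exact: cvg_cst.
have -> : (fun k : nat => gamma `^ (k%:R / 2)) = (fun k => Num.sqrt gamma ^+ k).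
  apply/funext => k; rewrite mulrC powRrM powR_mulrn ?powR_ge0//.
  by rewrite powR12_sqrt// ltW.
apply: cvg_expr; rewrite ger0_norm ?sqrtr_ge0//.
by rewrite -[X in _ < X]sqrtr1 ltr_sqrt.
Qed.

End Convergence.

(** * Linear spans and the restricted injectivity modulus *)

Section Span.
Variables (R : realType) (m : nat).

(** A finite family of vectors of S whose rank is maximal spans all of S. *)
Lemma lin_row_space (S : set 'rV[R]_m) :
  exists k (B : 'M[R]_(k, m)), lin S = [set v | (v <= B)%MS].
Proof.
pose P r := `[< exists k (B : 'M[R]_(k, m)),
  (forall i, S (row i B)) /\ \rank B = r >].
have exP : exists r, P r.
  by exists 0%N; apply/asboolP; exists 0%N, 0; split=> [[]//|]; rewrite mxrank0.
have ubP r : P r -> (r <= m)%N.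
  by move=> /asboolP [k [B [_ <-]]]; exact: rank_leq_col.
case: (ex_maxnP exP ubP) => r /asboolP [k [B [SB rB]]] hmax.
have sub s : S s -> (s <= B)%MS.
  move=> Ss; have : P (\rank (col_mx B s)).
    apply/asboolP; exists (k + 1)%N, (col_mx B s); split=> // i.
    case: (split_ordP i) => j ->; first by rewrite rowKu.
    by rewrite rowKd row_id.
  move=> /hmax; rewrite -rB -addsmxE => le.
  have /eqmxP/eqmx_sym e : (B == B + s)%MS.
    by rewrite -(geq_leqif (mxrank_leqif_eq (addsmxSl B s))).
  by rewrite -e addsmxSr.
exists k, B; apply/seteqP; split=> v /=.
  move=> [l [c [s [Ss ->]]]].
  by apply: summx_sub => i _; apply: scalemx_sub; exact: sub.
move=> /submxP [D ->]; exists k, (fun i => D 0 i), (fun i => row i B).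
by split=> //; rewrite mulmx_sum_row.
Qed.

Lemma linZ (S : set 'rV[R]_m) (a : R) v : lin S v -> lin S (a *: v).
Proof.
move=> [k [c [s [Ss ->]]]]; exists k, (fun i => a * c i), s; split=> //.
by rewrite scaler_sumr; apply: eq_bigr => i _; rewrite scalerA.
Qed.

Lemma lin_sub (S : set 'rV[R]_m) : S `<=` lin S.
Proof.
move=> s Ss; exists 1%N, (fun=> 1), (fun=> s); split=> //.
by rewrite big_ord1 scale1r.
Qed.

(** By lin_row_space the span is the kernel of a matrix, hence closed. *)
Lemma lin_sphere_compact (S : set 'rV[R]_m) :
  compact [set v | lin S v /\ frobenius v = 1].
Proof.
have [k [B ->]] := lin_row_space S.
apply: (subclosed_compact _ (@sphere_compact R m)); last by move=> v [].
have -> : [set v : 'rV[R]_m | [set v | (v <= B)%MS] v /\ frobenius v = 1] =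
    [set v | frobenius (v *m cokermx B) = 0] `&` [set v | frobenius v = 1].
  apply/seteqP; split=> v /=; rewrite submxE => -[h v1]; split=> //.
    by rewrite (eqP h) frobenius0.
  by rewrite (frobenius_eq0 h).
apply: closedI.
- apply: (preimage_closed (f := fun v : 'rV[R]_m => frobenius (v *m cokermx B))
    (D := [set 0])); last exact: closed_eq.
  move=> v _; have h : mx_continuous_at (fun v : 'rV[R]_m => v *m cokermx B) v.
    exact: (mx_continuousM (@mx_continuous_id _ _ _ v)
      (@mx_continuous_cst _ _ _ _ (cokermx B) v)).
  exact: (mx_continuous_frobenius h).
- apply: (preimage_closed (f := @frobenius R 1 m) (D := [set 1]));
    last exact: closed_eq.
  by move=> v _; exact: frobenius_continuous.
Qed.

End Span.

(** * Linear families of symmetric matrices *)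

(** The map Phi_T for arbitrary symmetric matrices in place of the Gramians. *)
Definition pencil (R : realType) (n m : nat) (W : 'I_m -> 'M[R]_n)
    (v : 'rV[R]_m) : 'M[R]_n :=
  \sum_i v 0 i *: W i.

Section Pencil.
Variables (R : realType) (n m : nat) (W : 'I_m -> 'M[R]_n).
Hypothesis symW : forall i, (W i)^T = W i.
Local Notation P := (pencil W).
Local Notation X := [set p : 'rV[R]_m | posdef (pencil W p)].

Lemma pencilDZ p (t : R) v : P (p + t *: v) = P p + t *: P v.
Proof.
rewrite /pencil scaler_sumr -big_split; apply: eq_bigr => i _.
by rewrite !mxE scalerDl scalerA.
Qed.

Lemma pencil0 : P 0 = 0.
Proof. by rewrite /pencil big1// => i _; rewrite mxE scale0r. Qed.

Lemma pencilZ (t : R) v : P (t *: v) = t *: P v.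
Proof. by rewrite -[t *: v]add0r pencilDZ pencil0 add0r. Qed.

Lemma pencilB p q : P (p - q) = P p - P q.
Proof. by rewrite -scaleN1r pencilDZ scaleN1r. Qed.

Lemma pencil_sym v : (P v)^T = P v.
Proof.
by rewrite /pencil linear_sum; apply: eq_bigr => i _; rewrite linearZ /= symW.
Qed.

Lemma pencil_delta i : P (delta_mx 0 i) = W i.
Proof.
rewrite /pencil (bigD1 i)//= mxE !eqxx scale1r big1 ?addr0// => j ji.
by rewrite mxE (negbTE ji) andbF scale0r.
Qed.

Lemma mx_continuous_pencil p : mx_continuous_at P p.
Proof.
move=> i j; have -> : (fun t => P t i j) = (fun t => \sum_k t 0 k * W k i j).
  by apply/funext => t; rewrite summxE; apply: eq_bigr => k _; rewrite mxE.
apply: continuous_at_sum => k _.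
exact: (cvgM (@coord_continuous R 1 m 0 k p) (cvg_cst _)).
Qed.

Definition pencil_mass : R := \sum_i frobenius (W i).

Lemma pencil_mass_ge0 : 0 <= pencil_mass.
Proof. by rewrite /pencil_mass sumr_ge0// => i _; exact: frobenius_ge0. Qed.

Lemma frobenius_le_pencil_mass i : frobenius (W i) <= pencil_mass.
Proof.
rewrite /pencil_mass (bigD1 i)//= lerDl; apply: sumr_ge0 => j _.
exact: frobenius_ge0.
Qed.

Lemma frobenius_pencil (v : 'rV[R]_m) (a : R) : (forall i, `|v 0 i| <= a) ->
  frobenius (P v) <= a * pencil_mass.
Proof.
move=> h; apply: le_trans (frobenius_sum _ _) _.
rewrite /pencil_mass mulr_sumr; apply: ler_sum => i _.
by rewrite frobeniusZ ler_wpM2r ?frobenius_ge0.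
Qed.

(** The form of P (p - q) is at most its Frobenius norm times |x|^2. *)
Lemma pencil_perturb (c : R) p q : form_ge c (P p) ->
  form_ge (c - frobenius (P (q - p))) (P q).
Proof.
move=> h x; have -> : P q = P p + (-1) *: P (p - q).
  by rewrite -pencilDZ scaleN1r opprB addrC subrK.
rewrite qformDZ mulN1r.
have := qform_le_frobenius (P (p - q)) x.
have -> : frobenius (P (p - q)) = frobenius (P (q - p)).
  by rewrite !pencilB frobenius_distC.
have := h x; rewrite mulrBl; lra.
Qed.

Lemma pencil_posdef_near (c : R) p q : form_ge c (P p) ->
  frobenius (P (q - p)) < c -> X q.
Proof.
move=> h lt; apply: (form_ge_posdef (pencil_sym q) _ (pencil_perturb q h)).
by rewrite subr_gt0.
Qed.

Lemma pencil_posdef_open p : X p -> \forall q \near p, X q.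
Proof.
move=> /posdef_form_ge [c c0 h].
have cont : mx_continuous_at (fun q : 'rV[R]_m => P (q - p)) p.
  move=> i j; have -> : (fun q : 'rV[R]_m => P (q - p) i j) =
      (fun q => P q i j - P p i j).
    by apply/funext => q; rewrite pencilB !mxE.
  exact: (cvgB (@mx_continuous_pencil p i j) (cvg_cst _)).
have hn := (cvgrPdist_lt (FF := nbhs_filter p) _ _).1
  (mx_continuous_frobenius cont) _ c0.
apply: filterS hn => q; rewrite subrr pencil0 frobenius0 sub0r normrN => lt.
exact: pencil_posdef_near h (le_lt_trans (ler_norm _) lt).
Qed.

Lemma pencil_posdef_convex p q (t : R) :
  X p -> X q -> 0 <= t <= 1 -> X (p + t *: (q - p)).
Proof.
move=> /= Xp Xq /andP[t0 t1]; split; first exact: pencil_sym.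
move=> x x0; have -> : P (p + t *: (q - p)) = (1 - t) *: P p + t *: P q.
  by rewrite pencilDZ pencilB scalerBr scalerBl scale1r addrAC -!addrA.
rewrite -/(qform _ x x) qformDZ -[_ *: P p]add0r qformDZ.
have -> : qform 0 x x = 0 by rewrite /qform mulmx0 mul0mx mxE.
rewrite add0r; have := Xp.2 x x0; have := Xq.2 x x0.
rewrite -!/(qform _ x x) => hq hp.
have [->|tn] := eqVneq t 0; first by rewrite subr0 mul1r mul0r addr0.
rewrite ltr_wpDl ?mulr_ge0 ?subr_ge0 ?(ltW hp)// mulr_gt0//.
by rewrite lt_neqAle eq_sym tn.
Qed.

Lemma form_ge_compact (C : set 'rV[R]_m) (c : R) : compact C ->
  compact (C `&` [set p | form_ge c (P p)]).
Proof.
move=> cC; apply: compact_closedI => //.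
have -> : [set p | form_ge c (P p)] = \bigcap_(x in [set: 'cV[R]_n])
    [set p | c * frobenius x ^+ 2 <= qform (P p) x x].
  by apply/seteqP; split=> p h x; [move=> _|]; exact: h.
apply: closed_bigI => x _.
apply: (preimage_closed (f := fun p => qform (P p) x x)
  (D := [set y | c * frobenius x ^+ 2 <= y])); last exact: closed_ge.
move=> p _; have h := mx_continuousM (mx_continuousM
  (@mx_continuous_cst _ _ _ _ x^T p) (@mx_continuous_pencil p))
  (@mx_continuous_cst _ _ _ _ x p).
exact: (h 0 0).
Qed.

End Pencil.

(** * The two scoring functions *)

(** The interface through which the two scoring functions enter the convergence
    proof. Here nu is the modulus of convexity in terms of the upper bound b of
    the pencil: b^-2 for - log det and 2 b^-3 for the trace of the inverse. *)
Record scoring (R : realType) (n m : nat) (W : 'I_m -> 'M[R]_n)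
    (f : 'rV[R]_m -> R) (nu : R -> R)
    (D1 : 'rV[R]_m -> 'rV[R]_m -> R)
    (D2 : 'rV[R]_m -> 'rV[R]_m -> 'rV[R]_m -> R) : Prop := {
  scoring_C2 : C2_data [set p | posdef (pencil W p)] f D1 D2;
  scoring_continuous : forall p, posdef (pencil W p) -> {for p, continuous f};
  scoring_bounded : forall c, 0 < c -> exists K, forall p,
    form_ge c (pencil W p) -> forall i j,
      `|D1 p (delta_mx 0 i)| <= K /\
      `|D2 p (delta_mx 0 i) (delta_mx 0 j)| <= K;
  scoring_convex : forall b p v, 0 < b -> posdef (pencil W p) ->
    (forall x, qform (pencil W p) x x <= b * frobenius x ^+ 2) ->
    nu b * frobenius (pencil W v) ^+ 2 <= D2 p v v;
  scoring_proper : forall (C : set 'rV[R]_m) l, C !=set0 -> compact C ->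
    exists2 c, 0 < c &
      forall p, C p -> posdef (pencil W p) -> f p <= l ->
        form_ge c (pencil W p)
}.

Section Scoring.
Variables (R : realType) (n m : nat) (W : 'I_m -> 'M[R]_n).
Hypothesis symW : forall i, (W i)^T = W i.
Local Notation P := (pencil W).
Local Notation X := [set p : 'rV[R]_m | posdef (pencil W p)].
Local Notation S p := (invmx (pencil W p)).
Local Notation e_ i := (delta_mx 0 i : 'rV[R]_m).

(** Expands each occurrence of P v in D1 and D2 over the basis. *)
Lemma trace_pencil_sum (A B : 'M[R]_n) (v : 'rV[R]_m) :
  \tr (A *m P v *m B) = \sum_i v 0 i * \tr (A *m P (e_ i) *m B).
Proof.
have -> : P v = \sum_i v 0 i *: P (e_ i).
  by rewrite {1}/pencil; apply: eq_bigr => i _; rewrite pencil_delta.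
rewrite mulmx_sumr mulmx_suml linear_sum /=; apply: eq_bigr => i _.
by rewrite -scalemxAr -scalemxAl mxtraceZ.
Qed.

Lemma pencil_line (p v : 'rV[R]_m) (h : R) : P (h *: v + p) = P p + h *: P v.
Proof. by rewrite addrC pencilDZ. Qed.

Lemma mx_is_derive_invP (p v : 'rV[R]_m) : X p ->
  mx_is_derive p v (fun q => S q) (- (S p *m P v *m S p)).
Proof.
move=> Xp; apply: mx_is_derive_inv; first exact: pencil_line.
exact: posdef_unitmx.
Qed.

Lemma mx_continuous_invP p : X p -> mx_continuous_at (fun q => S q) p.
Proof.
move=> Xp; apply: mx_continuous_inv; first exact: mx_continuous_pencil.
exact: posdef_unitmx.
Qed.

Lemma frobenius_invP_le (c : R) p : 0 < c -> form_ge c (P p) ->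
  frobenius (S p) <= n%:R / c.
Proof.
move=> c0 h; have Xp : X p := form_ge_posdef (pencil_sym symW p) c0 h.
apply: le_trans (invmx_trace_le Xp c0 h).
apply: psd_frobenius_le_trace; first exact: invmx_posdef_sym.
exact: invmx_psd.
Qed.

Lemma frobenius_P_delta i : frobenius (P (e_ i)) <= pencil_mass W.
Proof. by rewrite pencil_delta; exact: frobenius_le_pencil_mass. Qed.

Definition logdet_D1 (p v : 'rV[R]_m) : R := - \tr (S p *m P v).
Definition logdet_D2 (p v w : 'rV[R]_m) : R :=
  \tr (S p *m P v *m S p *m P w).

Lemma logdet_C2 :
  C2_data X (fun p => - ln (\det (P p))) logdet_D1 logdet_D2.
Proof.
split.
- by move=> p; exact: pencil_posdef_open.
- move=> p v Xp; apply: is_deriveN; apply/is_derive_line0.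
  have -> : (fun s : R => ln (\det (P (p + s *: v)))) =
      (fun s : R => ln (\det (P p + s *: P v))).
    by apply/funext => s; rewrite pencilDZ.
  exact: is_derive_lndet.
- move=> p v w Xp; rewrite /logdet_D1 /logdet_D2.
  have hM := mx_is_deriveM (mx_is_derive_invP v Xp)
    (@mx_is_derive_cst _ _ _ _ p v (P w)).
  apply: is_derive_eq; first exact: is_deriveN (is_derive_trace hM).
  by rewrite mulmx0 addr0 mulNmx linearN opprK.
- move=> p v; rewrite /logdet_D1 -[S p *m P v]mulmx1 trace_pencil_sum -sumrN.
  by apply: eq_bigr => i _; rewrite mulmx1 mulrN.
- move=> p v w; rewrite /logdet_D2 -mulmxA trace_pencil_sum.
  apply: eq_bigr => i _; rewrite mulmxA -[_ *m P w]mulmx1 trace_pencil_sum.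
  rewrite mulr_sumr; apply: eq_bigr => j _.
  by rewrite mulmx1 mulrA.
Qed.

Lemma continuous_detP p : {for p, continuous (fun q => \det (P q))}.
Proof. exact: mx_continuous_det (@mx_continuous_pencil _ _ _ W p). Qed.

(** For properness, the trace of the inverse is the trace of the adjugate, which
    is bounded on C, divided by the determinant, which is at least exp (- l)
    where the function is at most l. *)
Lemma logdet_scoring : scoring W (fun p => - ln (\det (P p)))
  (fun b => b^-1 ^+ 2) logdet_D1 logdet_D2.
Proof.
split.
- exact: logdet_C2.
- move=> p Xp.
  have h : {for p, continuous (@ln R \o (fun q => \det (P q)))}.
    apply: continuous_comp; first exact: continuous_detP.
    by apply: continuous_ln; exact: posdef_det_gt0.
  exact: (cvgN h).
- move=> c c0; set s := n%:R / c; set w := pencil_mass W.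
  exists (Num.max (s * w) (s * w * (s * w))) => p h i j.
  have hS := frobenius_invP_le c0 h.
  have hi := frobeniusM_le hS (frobenius_P_delta i).
  have hj := frobeniusM_le hS (frobenius_P_delta j).
  split; rewrite le_max; apply/orP; [left|right].
    by rewrite /logdet_D1 normrN; apply: mxtraceM_le => //;
      exact: frobenius_P_delta.
  by rewrite /logdet_D2 -mulmxA; exact: mxtraceM_le.
- move=> b p v b0 Xp hb; apply: trace_SVSV_ge.
  + by rewrite invr_gt0.
  + exact: invmx_posdef_sym.
  + exact: pencil_sym.
  + exact: invmx_form_ge.
- move=> C l C0 cC.
  have ctr p : {for p, continuous (fun q => \tr (\adj (P q)))}.
    exact: mx_continuous_trace
      (mx_continuous_adj (@mx_continuous_pencil _ _ _ W p)).
  have [q _ hq] := compact_EVT_max C0 cC (continuous_subspaceT ctr).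
  pose B := `|\tr (\adj (P q))|; pose d := expR (- l).
  have d0 : 0 < d by exact: expR_gt0.
  have B0 : 0 <= B by exact: normr_ge0.
  have t0 : 0 < B / d + 1 by rewrite ltr_wpDl// divr_ge0// ltW.
  exists (B / d + 1)^-1; first by rewrite invr_gt0.
  move=> p Cp Xp fl; apply: form_ge_of_invmx_trace => //.
  have D0 := posdef_det_gt0 Xp.
  have dD : d <= \det (P p) by rewrite -ler_ln ?posrE// expRK lerNl.
  rewrite /invmx posdef_unitmx// mxtraceZ.
  apply: (@le_trans _ _ ((\det (P p))^-1 * B)).
    rewrite ler_wpM2l ?invr_ge0 ?(ltW D0)//.
    by apply: le_trans (hq p _) (ler_norm _); rewrite inE.
  apply: (@le_trans _ _ (B / d)); last by rewrite lerDl.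
  by rewrite mulrC ler_wpM2l// lef_pV2.
Qed.

Definition trinv_D1 (p v : 'rV[R]_m) : R := - \tr (S p *m P v *m S p).
Definition trinv_D2 (p v w : 'rV[R]_m) : R :=
  \tr (S p *m P v *m S p *m P w *m S p) +
  \tr (S p *m P w *m S p *m P v *m S p).

Lemma trinv_C2 :
  C2_data X (fun p => \tr (S p)) trinv_D1 trinv_D2.
Proof.
split.
- by move=> p; exact: pencil_posdef_open.
- move=> p v Xp; rewrite /trinv_D1 -[- \tr _]linearN.
  exact: is_derive_trace (mx_is_derive_invP v Xp).
- move=> p v w Xp; rewrite /trinv_D1 /trinv_D2.
  have hI := mx_is_derive_invP v Xp.
  have hM := mx_is_deriveM hI (@mx_is_derive_cst _ _ _ _ p v (P w)).
  apply: is_derive_eq.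
    exact: is_deriveN (is_derive_trace (mx_is_deriveM hM hI)).
  rewrite mulmx0 addr0 mulmxN !mulNmx mxtraceD !linearN opprD !opprK.
  by rewrite !mulmxA.
- move=> p v; rewrite /trinv_D1 trace_pencil_sum -sumrN.
  by apply: eq_bigr => i _; rewrite mulrN.
- move=> p v w; rewrite /trinv_D2.
  have e (A B : 'M[R]_n) : \tr (A *m P v *m B *m P w *m A) =
      \sum_i \sum_j v 0 i * w 0 j *
        \tr (A *m P (e_ i) *m B *m P (e_ j) *m A).
    rewrite -!mulmxA (mulmxA A) trace_pencil_sum; apply: eq_bigr => i _.
    rewrite !mulmxA trace_pencil_sum mulr_sumr; apply: eq_bigr => j _.
    by rewrite mulrA.
  have e' (A B : 'M[R]_n) : \tr (A *m P w *m B *m P v *m A) =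
      \sum_i \sum_j v 0 i * w 0 j *
        \tr (A *m P (e_ j) *m B *m P (e_ i) *m A).
    rewrite trace_pencil_sum; apply: eq_bigr => i _.
    rewrite -!mulmxA (mulmxA A) trace_pencil_sum mulr_sumr.
    by apply: eq_bigr => j _; rewrite !mulmxA mulrA.
  rewrite e e' -big_split; apply: eq_bigr => i _.
  by rewrite -big_split; apply: eq_bigr => j _; rewrite mulrDr.
Qed.

Lemma trinv_scoring : scoring W (fun p => \tr (S p))
  (fun b => 2 * b^-1 ^+ 3) trinv_D1 trinv_D2.
Proof.
split.
- exact: trinv_C2.
- by move=> p Xp; exact: mx_continuous_trace (mx_continuous_invP Xp).
- move=> c c0; set s := n%:R / c; set w := pencil_mass W.
  exists (Num.max (s * w * s) (s * w * (s * w) * s + s * w * (s * w) * s)).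
  move=> p h i j.
  have hS := frobenius_invP_le c0 h.
  have hi := frobeniusM_le hS (frobenius_P_delta i).
  have hj := frobeniusM_le hS (frobenius_P_delta j).
  split; rewrite le_max; apply/orP; [left|right].
    by rewrite /trinv_D1 normrN; exact: mxtraceM_le.
  apply: le_trans (ler_normD _ _) _; apply: lerD.
    rewrite -(mulmxA _ (S p) (P (e_ j))).
    exact: mxtraceM_le (frobeniusM_le hi hj) hS.
  rewrite -(mulmxA _ (S p) (P (e_ i))).
  exact: mxtraceM_le (frobeniusM_le hj hi) hS.
- move=> b p v b0 Xp hb; rewrite /trinv_D2 -mulrA mulr_natl mulr2n.
  by apply: lerD; (apply: trace_SVSVS_ge;
    [rewrite invr_gt0|exact: invmx_posdef_sym|exact: pencil_sym
    |exact: invmx_form_ge]).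
- move=> C l C0 cC; have t0 : 0 < `|l| + 1 by rewrite ltr_wpDl.
  exists (`|l| + 1)^-1; first by rewrite invr_gt0.
  move=> p Cp Xp fl; apply: form_ge_of_invmx_trace => //.
  by apply: le_trans fl _; apply: le_trans (ler_norm _) _; rewrite lerDl.
Qed.

End Scoring.

(** * Existence, conditioning and convergence for a scoring function *)

Section Assembly.
Variables (R : realType) (n m : nat) (W : 'I_m -> 'M[R]_n).
Hypothesis symW : forall i, (W i)^T = W i.
Local Notation P := (pencil W).
Local Notation X := [set p : 'rV[R]_m | posdef (pencil W p)].
Variables (f : 'rV[R]_m -> R) (nu : R -> R).
Variables (D1 : 'rV[R]_m -> 'rV[R]_m -> R).
Variables (D2 : 'rV[R]_m -> 'rV[R]_m -> 'rV[R]_m -> R).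
Hypothesis hf : scoring W f nu D1 D2.
Hypothesis nu0 : forall b, 0 < b -> 0 < nu b.
Variable C : set 'rV[R]_m.
Hypotheses (Csimplex : C `<=` simplex R m) (compactC : compact C).
Hypothesis convexC : convex_set C.
Hypothesis CX0 : C `&` X !=set0.
Let L := lin (set_diff_vec C).

Let C0 : C !=set0.
Proof. by have [p [Cp _]] := CX0; exists p. Qed.

Lemma feasible_convex p q (t : R) : (C `&` X) p -> (C `&` X) q -> 0 <= t <= 1 ->
  (C `&` X) (p + t *: (q - p)).
Proof.
move=> [Cp Xp] [Cq Xq] t01; split; first exact: convex_set_segment.
exact: pencil_posdef_convex.
Qed.

(** Minimize over the compact set where the pencil is at least c I; properness
    keeps the sublevel set of any given feasible point inside it. *)
Lemma minimizer_exists : exists ps, is_optimal f (C `&` X) ps.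
Proof.
have [p1 [Cp1 Xp1]] := CX0.
have [c c0 hc] := scoring_proper hf (f p1) C0 compactC.
pose K := C `&` [set p | form_ge c (P p)].
have K1 : K p1 by split=> //; exact: hc.
have KX p : K p -> X p.
  by move=> [_ h]; exact: form_ge_posdef (pencil_sym symW p) c0 h.
have contK : {within K, continuous f}.
  apply: continuous_in_subspaceT => p /set_mem Kp.
  by apply: (scoring_continuous hf); exact: KX.
have [ps /set_mem Ks hs] := compact_EVT_min (ex_intro _ p1 K1)
  (@form_ge_compact _ _ _ W C c compactC) contK.
exists ps; split; first by split; [case: Ks|exact: KX].
move=> q [Cq Xq]; have [le|lt] := leP (f q) (f p1).
  by apply: hs; rewrite inE; split=> //; exact: hc.
by apply: le_trans (ltW lt); apply: hs; rewrite inE.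
Qed.

Lemma set_diff_lin p q : C p -> C q -> L (q - p).
Proof. by move=> Cp Cq; apply: lin_sub; exists q => //; exists p. Qed.

Lemma lin_trivial_unique p q : L = [set 0] -> C p -> C q -> p = q.
Proof.
move=> L0 Cp Cq; have := set_diff_lin Cp Cq; rewrite L0 => /eqP.
by rewrite subr_eq0 eq_sym => /eqP.
Qed.

Hypothesis kerL : [set v | P v = 0] `&` L = [set 0].
Hypothesis L0 : L <> [set 0].

Definition pencil_kappa : R :=
  inf [set frobenius (P v) | v in [set v | L v /\ frobenius v = 1]].

Definition pencil_beta : R := sup [set lambda_max (P p) | p in C].

Lemma lin_unit_exists : exists v, L v /\ frobenius v = 1.
Proof.
apply: contrapT => h; apply: L0; apply/seteqP; split=> v.
  move=> Lv /=; apply/eqP/negPn/negP => v0; apply: h.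
  exists ((frobenius v)^-1 *: v); split; first exact: linZ.
  have f0 := frobenius_gt0 v0.
  by rewrite frobeniusZ ger0_norm ?invr_ge0 ?(ltW f0)// mulVf// gt_eqF.
by move=> ->; have [] : ([set v | P v = 0] `&` L) 0 by rewrite kerL.
Qed.

Lemma pencil_lin_inj v : L v -> P v = 0 -> v = 0.
Proof.
by move=> Lv Pv; have : ([set v | P v = 0] `&` L) v by []; rewrite kerL.
Qed.

(** Matrices of size zero are all equal, so the kernel of P would be
    everything. *)
Lemma pencil_size_gt0 : (0 < n)%N.
Proof.
rewrite lt0n; apply/eqP => n0; have [v [Lv v1]] := lin_unit_exists.
have Pv : P v = 0.
  by apply/matrixP => i; have := ltn_ord i; rewrite [X in (_ < X)%N]n0.
move: v1; rewrite (pencil_lin_inj Lv Pv) frobenius0 => /eqP.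
by rewrite eq_sym oner_eq0.
Qed.

(** The minimum of |P v| over the unit sphere of the span is attained, and the
    minimizer is not in the kernel of P. *)
Lemma pencil_kappa_gt0 : 0 < pencil_kappa.
Proof.
have [v1 hv1] := lin_unit_exists.
have cont : continuous (fun v => frobenius (P v)).
  by move=> v; exact: mx_continuous_frobenius (@mx_continuous_pencil _ _ _ W v).
have [v0 /set_mem [Lv0 v01] hv] := compact_EVT_min (ex_intro _ v1 hv1)
  (@lin_sphere_compact R m (set_diff_vec C)) (continuous_subspaceT cont).
apply: (@lt_le_trans _ _ (frobenius (P v0))).
  apply: frobenius_gt0; apply/eqP => Pv; move: v01.
  rewrite (pencil_lin_inj Lv0 Pv) frobenius0 => /eqP.
  by rewrite eq_sym oner_eq0.
apply: lb_le_inf; first by exists (frobenius (P v1)), v1.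
by move=> _ [v hvv <-]; apply: hv; rewrite inE.
Qed.

Lemma pencil_kappa_le v : L v -> pencil_kappa * frobenius v <= frobenius (P v).
Proof.
move=> Lv; have [->|v0] := eqVneq v 0.
  by rewrite frobenius0 mulr0 frobenius_ge0.
have f0 := frobenius_gt0 v0.
have i0 : 0 <= (frobenius v)^-1 by rewrite invr_ge0 ltW.
rewrite -ler_pdivlMr// mulrC -[(frobenius v)^-1]ger0_norm//.
rewrite -frobeniusZ -pencilZ.
apply: ge_inf; first by exists 0 => _ [x _ <-]; exact: frobenius_ge0.
exists ((frobenius v)^-1 *: v) => //; split; first exact: linZ.
by rewrite frobeniusZ ger0_norm// mulVf// gt_eqF.
Qed.

(** The coordinates of a point of the simplex are at most 1, which bounds the
    eigenvalues of the pencil on C. *)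
Lemma pencil_beta_ge p : C p -> lambda_max (P p) <= pencil_beta.
Proof.
move=> Cp; apply: ub_le_sup; last by exists p.
exists (1 * pencil_mass W) => _ [q Cq <-].
apply: le_trans (lambda_max_le_frobenius _) _; apply: frobenius_pencil => i.
have [q0 q1] := Csimplex Cq; rewrite ger0_norm// -q1 (bigD1 i)//= lerDl.
by apply: sumr_ge0 => j _.
Qed.

Lemma qform_le_beta p x : C p ->
  qform (P p) x x <= pencil_beta * frobenius x ^+ 2.
Proof.
move=> Cp; apply: le_trans (qform_le_lambda_max x (pencil_sym symW p)) _.
by rewrite ler_wpM2r ?sqr_ge0// pencil_beta_ge.
Qed.

Lemma pencil_beta_gt0 : 0 < pencil_beta.
Proof.
have [p [Cp Xp]] := CX0.
have x0 : (delta_mx (Ordinal pencil_size_gt0) 0 : 'cV[R]_n) != 0.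
  apply/eqP => /(congr1 (@frobenius R n 1)).
  by rewrite frobenius_delta frobenius0 => /eqP; rewrite oner_eq0.
have := qform_le_beta (delta_mx (Ordinal pencil_size_gt0) 0) Cp.
rewrite frobenius_delta expr1n mulr1; apply: lt_le_trans.
exact: (Xp.2 _ x0).
Qed.

Definition pencil_mu : R := nu pencil_beta * pencil_kappa ^+ 2.

Lemma pencil_mu_gt0 : 0 < pencil_mu.
Proof.
by rewrite mulr_gt0 ?exprn_gt0 ?pencil_kappa_gt0// nu0// pencil_beta_gt0.
Qed.

(** On the segment from p to q the pencil is at most beta I, and q - p lies in
    the span of C - C, where kappa bounds P from below. *)
Lemma scoring_strongly_convex p q : (C `&` X) p -> (C `&` X) q ->
  f p + dot (grad f p) (q - p) + pencil_mu / 2 * frobenius (q - p) ^+ 2 <= f q.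
Proof.
move=> hp hq; have Lv := set_diff_lin hp.1 hq.1.
have -> : pencil_mu / 2 * frobenius (q - p) ^+ 2 =
    pencil_mu * frobenius (q - p) ^+ 2 / 2 by ring.
have hs (t : R) : 0 <= t <= 1 -> (C `&` X) (p + t *: (q - p)).
  exact: feasible_convex.
apply: (C2_taylor_ge (scoring_C2 hf)) => t t01; have [Ct Xt] := hs t t01 => //.
apply: le_trans (scoring_convex hf (q - p) pencil_beta_gt0 Xt _); last first.
  by move=> x; exact: qform_le_beta.
rewrite /pencil_mu -mulrA ler_wpM2l ?(ltW (nu0 pencil_beta_gt0))// -exprMn.
rewrite ler_pXn2r ?nnegrE ?mulr_ge0 ?frobenius_ge0 ?(ltW pencil_kappa_gt0)//.
exact: pencil_kappa_le.
Qed.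

Variable p0 : 'rV[R]_m.
Hypothesis CXp0 : (C `&` X) p0.
Let F0 := sublevel f C X p0.

Let F00 : F0 !=set0.
Proof. by exists p0; case: CXp0. Qed.

Lemma sublevel_form_ge : exists2 c, 0 < c & forall p, F0 p -> form_ge c (P p).
Proof.
have [c c0 hc] := scoring_proper hf (f p0) C0 compactC.
by exists c => // p [Cp Xp fp]; exact: hc.
Qed.

(** A perturbation smaller than c / (|W_1| + ... + |W_m| + 1) moves the pencil
    by less than c in norm. *)
Lemma sublevel_dist_gt0 : 0 < dist F0 (~` X).
Proof.
have [c c0 hc] := sublevel_form_ge.
have M0 : 0 < pencil_mass W + 1 by rewrite ltr_wpDl// pencil_mass_ge0.
apply: (@lt_le_trans _ _ (c / (pencil_mass W + 1))); first by rewrite divr_gt0.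
apply: dist_ge => //.
  (* the zero vector is outside X because n > 0 *)
  exists 0 => /= -[_] /(_ (delta_mx (Ordinal pencil_size_gt0) 0)).
  rewrite pencil0 mulmx0 mul0mx mxE ltxx => H.
  suff : false by []; apply: H; apply/eqP => /(congr1 (@frobenius R n 1)).
  by rewrite frobenius_delta frobenius0 => /eqP; rewrite oner_eq0.
move=> p q Fp nXq; rewrite ler_pdivrMr// leNgt; apply/negP => lt; apply: nXq.
apply: (pencil_posdef_near symW (hc _ Fp)); apply: le_lt_trans lt.
apply: (@le_trans _ _ (frobenius (p - q) * pencil_mass W)).
  apply: frobenius_pencil => i.
  by rewrite frobenius_distC; exact: frobenius_coord.
by rewrite ler_wpM2l ?frobenius_ge0// lerDl.
Qed.

(** A point of the neighborhood lies at three quarters, at most, of the way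
    from a point of the sublevel set to another point of X: by linearity the
    pencil keeps a quarter of its lower bound. *)
Lemma neighborhood_form_ge (c : R) : 0 < c ->
  (forall p, F0 p -> form_ge c (P p)) ->
  forall q, neighborhood f C X p0 q -> form_ge (c / 4) (P q).
Proof.
move=> c0 hc q /(neighborhood_close sublevel_dist_gt0 F00) [p Fp lt] x.
pose z := p + (4 / 3) *: (q - p).
have Xz : X z.
  apply: (dist_compl_in Fp).
  rewrite /z addrAC subrr add0r frobeniusZ ger0_norm; last by lra.
  rewrite -(@ltr_pM2l _ (3 / 4)); last by lra.
  have -> : 3 / 4 * (4 / 3 * frobenius (q - p)) = frobenius (q - p) by field.
  exact: lt.
have -> : P q = (1 / 4) *: P p + (3 / 4) *: P z.
  rewrite /z pencilDZ scalerDr scalerA addrA -scalerDl pencilB scalerBr.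
  have -> : 3 / 4 * (4 / 3) = 1 :> R by field.
  have -> : 1 / 4 + 3 / 4 = 1 :> R by field.
  by rewrite !scale1r subrKC.
rewrite -[_ *: P p]add0r !qformDZ.
have -> : qform (0 : 'M[R]_n) x x = 0 by rewrite /qform mulmx0 mul0mx mxE.
have := hc _ Fp x; have := posdef_psd Xz x; lra.
Qed.

Lemma sublevel_grad_bounded :
  exists G, forall p, F0 p -> frobenius (grad f p) <= G.
Proof.
have [c c0 hc] := sublevel_form_ge; have [K hK] := scoring_bounded hf c0.
exists (Num.sqrt (\sum_(i < 1) \sum_(j < m) K ^+ 2)) => p Fp.
apply: frobenius_le_entries => i j; rewrite mxE.
have d := C2_D1 (scoring_C2 hf) (delta_mx 0 j) (let: And3 _ Xp _ := Fp in Xp).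
by rewrite derive_val; case: (hK p (hc _ Fp) j j).
Qed.

Lemma neighborhood_hessian_bounded : exists H, forall q,
  neighborhood f C X p0 q -> frobenius (hessian f q) <= H.
Proof.
have [c c0 hc] := sublevel_form_ge.
have c40 : 0 < c / 4 by rewrite divr_gt0.
have [K hK] := scoring_bounded hf c40.
exists (Num.sqrt (\sum_(i < m) \sum_(j < m) K ^+ 2)) => q Nq.
apply: frobenius_le_entries => i j; rewrite (hessianE (scoring_C2 hf)).
  by case: (hK q (neighborhood_form_ge c0 hc Nq) i j).
exact: neighborhood_sub sublevel_dist_gt0 F00 _ Nq.
Qed.

Lemma scoring_accept (sigma a : R) p : sigma < 1 -> F0 p ->
  0 < a <= alpha_star f C X p0 sigma -> armijo f C X sigma p a.
Proof.
have [G hG] := sublevel_grad_bounded.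
have [H hH] := neighborhood_hessian_bounded.
exact: (armijo_accept (scoring_C2 hf) C0 compactC convexC sublevel_dist_gt0
  F00 hG hH).
Qed.

End Assembly.

Lemma scoring_convergence (R : realType) (n m : nat) (W : 'I_m -> 'M[R]_n)
    (f : 'rV[R]_m -> R) (nu : R -> R)
    (D1 : 'rV[R]_m -> 'rV[R]_m -> R)
    (D2 : 'rV[R]_m -> 'rV[R]_m -> 'rV[R]_m -> R) (C : set 'rV[R]_m) :
  let X := [set p | posdef (pencil W p)] in
  let mu := pencil_mu W nu C in
  (forall i, (W i)^T = W i) -> scoring W f nu D1 D2 ->
  (forall b, 0 < b -> 0 < nu b) ->
  C `<=` simplex R m -> compact C -> convex_set C -> C `&` X !=set0 ->
  [set v | pencil W v = 0] `&` lin (set_diff_vec C) = [set 0] ->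
  exists ps : 'rV[R]_m,
    unique (is_optimal f (C `&` X)) ps /\
    (lin (set_diff_vec C) <> [set 0] ->
     forall (p0 : 'rV[R]_m) (abar sigma rho : R),
       (C `&` X) p0 -> 0 < abar -> 0 < sigma < 1 -> 0 < rho < 1 ->
       let gamma :=
         1 - sigma * Num.min 1 (mu * alpha_low f C X p0 abar sigma rho) in
       [/\ 0 < gamma < 1,
           terminates_at f C X abar sigma rho 0 p0 ps \/
           (exists x : nat -> 'rV[R]_m,
              runs_forever f C X abar sigma rho 0 p0 x /\ x @ \oo --> ps)
         & forall (k : nat) (p : 'rV[R]_m),
             iterate f C X abar sigma rho 0 p0 k p ->
             frobenius (p - ps)
               <= Num.sqrt (2 * (f p0 - f ps) / mu) * gamma `^ (k%:R / 2)]).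
Proof.
move=> X mu symW hf nu0 Cs cC vC CX0 ker.
have [ps opt] := minimizer_exists symW hf cC CX0.
exists ps; have [L0|L0] := pselect (lin (set_diff_vec C) = [set 0]).
  split=> //; split=> // q [[Cq _] _].
  exact: (lin_trivial_unique L0 opt.1.1 Cq).
have C0 : C !=set0 by exists ps; exact: opt.1.1.
have vCX := feasible_convex symW vC.
have mu0 : 0 < mu by exact: pencil_mu_gt0.
have sc := scoring_strongly_convex symW hf nu0 Cs vC CX0 ker L0.
split.
  split=> // q [CXq hq].
  by rewrite (optimal_unique vCX mu0 sc opt CXq (hq _ opt.1)).
move=> _ p0 abar sigma rho CXp0 abar0 s01 r01 gamma.
have s1 : sigma < 1 by case/andP: s01.
have acc (p : 'rV[R]_m) (a : R) : sublevel f C X p0 p ->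
    0 < a <= alpha_star f C X p0 sigma -> armijo f C X sigma p a.
exact: (scoring_accept symW hf cC vC CX0 ker L0 CXp0 s1).
have d0 := sublevel_dist_gt0 symW hf cC CX0 ker L0 CXp0.
have as0 : 0 < alpha_star f C X p0 sigma by exact: (alpha_star_gt0 d0 s1).
split.
- exact: gamma_in01.
- exact: (terminates_or_converges C0 cC vC vCX mu0 sc opt).
- by move=> k p; exact: (iterate_linear_rate C0 cC vC vCX mu0 sc opt).
Qed.

(** * Gramians *)

Section Gramian.
Variable R : realType.

Lemma trmx_exp n (M : 'M[R]_n) k : (M ^+ k)^T = M^T ^+ k.
Proof.
elim: k => [|k IH]; first by rewrite !expr0 trmx1.
by rewrite exprSr exprS -IH; exact: trmx_mul.
Qed.

Lemma cvg_trmx n (u : nat -> 'M[R]_n) (l : 'M[R]_n) :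
  u @ \oo --> l -> (fun k => (u k)^T) @ \oo --> l^T.
Proof.
move=> /cvgrPdist_le h; apply/cvgrPdist_le => e e0.
apply: filterS (h e e0) => k.
rewrite !/Num.Def.normr /= !mx_normrE => hk.
apply: bigmax_le => [|[i j] _]; first exact: ltW.
apply: le_trans hk; rewrite !mxE /=.
by have := le_bigmax 0 (fun i : 'I_n * 'I_n => `|(l - u k) i.1 i.2|) (j, i);
  rewrite !mxE.
Qed.

Lemma lim_trmx n (u : nat -> 'M[R]_n) :
  limn (fun k => (u k)^T) = (limn u)^T.
Proof.
have [cu|du] := pselect (cvgn u).
  by apply: cvg_lim => //; exact: cvg_trmx.
have du' : ~ cvgn (fun k => (u k)^T).
  move=> /cvg_ex [l ul]; apply: du; apply/cvg_ex; exists l^T.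
  have -> : u = (fun k => ((u k)^T)^T) by apply/funext => k; rewrite trmxK.
  exact: cvg_trmx.
(* without convergence both limits are the default matrix, which is constant *)
rewrite (dvgP du) (dvgP du').
by apply/matrixP => i j; rewrite !mxE.
Qed.

Lemma mxexp_tr n (M : 'M[R]_n) : mxexp M^T = (mxexp M)^T.
Proof.
rewrite /mxexp -lim_trmx; congr (limn _); apply/funext => k.
rewrite /series /= linear_sum; apply: eq_bigr => i _.
by rewrite linearZ /= trmx_exp.
Qed.

(** Transposition exchanges the two exponential factors of the integrand. *)
Lemma gramian_sym n m (A : 'M[R]_n) (b : 'I_m -> 'cV[R]_n) (T : R) i :
  (gramian A b T i)^T = gramian A b T i.
Proof.
apply/matrixP => j k; rewrite !mxE; congr (Rintegral _ _ _).
apply/funext => t.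
have -> : t *: A^T = (t *: A)^T by rewrite linearZ.
set E := mxexp _; rewrite mxexp_tr -/E.
have e : (E *m b i *m (b i)^T *m E^T)^T = E *m b i *m (b i)^T *m E^T.
  by rewrite !trmx_mul !trmxK !mulmxA.
by rewrite -{1}e mxE.
Qed.

End Gramian.

Theorem theorem5 (R : realType) (n m : nat) (A : 'M[R]_n)
    (b : 'I_m -> 'cV[R]_n) (T : R) (C : set 'rV[R]_m)
    (f : 'rV[R]_m -> R) (mu : R) :
  (0 < m)%N ->
  0 < T ->
  C `<=` simplex R m ->
  C !=set0 ->
  compact C ->
  convex_set C ->
  C `&` X_ A b T !=set0 ->
  [set v | Phi A b T v = 0] `&` lin (set_diff_vec C) = [set 0] ->
  (f = fV A b T /\ mu = muV A b T C) \/ (f = fA A b T /\ mu = muA A b T C) ->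
  exists pstar : 'rV[R]_m,
    unique (is_optimal f (C `&` X_ A b T)) pstar /\
    (lin (set_diff_vec C) <> [set 0] ->
     forall (p0 : 'rV[R]_m) (abar sigma rho : R),
       (C `&` X_ A b T) p0 ->
       0 < abar -> 0 < sigma < 1 -> 0 < rho < 1 ->
       let gamma :=
         1 - sigma * Num.min 1 (mu * alpha_low f C (X_ A b T) p0 abar sigma rho)
       in
       [/\ 0 < gamma < 1,
           terminates_at f C (X_ A b T) abar sigma rho 0 p0 pstar \/
           (exists x : nat -> 'rV[R]_m,
              runs_forever f C (X_ A b T) abar sigma rho 0 p0 x /\
              x @ \oo --> pstar)
         & forall (k : nat) (p : 'rV[R]_m),
             iterate f C (X_ A b T) abar sigma rho 0 p0 k p ->
             frobenius (p - pstar)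
               <= Num.sqrt (2 * (f p0 - f pstar) / mu)
                  * gamma `^ (k%:R / 2)]).
Proof.
move=> _ _ Cs C0 cC vC CX0 ker hfmu.
pose W := gramian A b T.
have symW i : (W i)^T = W i by exact: gramian_sym.
case: hfmu => -[-> ->].
- have -> : muV A b T C = pencil_mu W (fun b => b^-1 ^+ 2) C.
    by rewrite /pencil_mu exprVn mulrC.
  apply: (scoring_convergence symW (logdet_scoring symW)) => // c c0.
  by rewrite exprn_gt0// invr_gt0.
- have -> : muA A b T C = pencil_mu W (fun b => 2 * b^-1 ^+ 3) C.
    by rewrite /pencil_mu exprVn mulrAC.
  apply: (scoring_convergence symW (trinv_scoring symW)) => // c c0.
  by rewrite mulr_gt0// exprn_gt0// invr_gt0.
Qed.
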